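(* Let $H$ be a pivotal Hopf monoid in a symmetric monoidal category $\mathcal C$. (1) The slides $D_a,D_b$ define a group homomorphism $\rho: B_3\to \mathrm{Aut}_{YD}(H^{\otimes 2})$, $A\mapsto D_a$, $B\mapsto D_b$. (2) If $\mathcal C$ is finitely complete and cocomplete, the slides $D_a,D_b$ induce a group homomorphism $\rho:\mathrm{SL}(2,\mathbb Z)\to \mathrm{Aut}(H^{\otimes 2}_{inv})$.
   Context: $(H,p)$ is a pivotal Hopf monoid (Hopf monoid with $p:e\to H$, $\Delta\circ p=p\otimes p$, $\epsilon\circ p=1_e$, $m^{2}\circ(1_H\otimes S^2\otimes S)\circ(p\otimes 1_H\otimes p)=1_H$), and $T=m\circ(p\otimes S)$. The torus (resp. one-holed torus) is described by a ribbon graph with one ciliated vertex and two oriented loops $a$ (first copy of $H$) and $b$ (second copy), forming a single face; Sweedler notation is shorthand for diagrams in $\mathcal C$. $H^{\otimes 2}$ carries the left-left Yetter-Drinfeld module structure $\rhd_v: h\otimes a\otimes b\mapsto h_{(3)}aS(h_{(1)})\otimes h_{(4)}bS(h_{(2)})$, $\delta_f: a\otimes b\mapsto T(a_{(3)})b_{(1)}a_{(1)}T(b_{(3)})\otimes a_{(2)}\otimes b_{(2)}$; $\mathrm{Aut}_{YD}$ denotes automorphisms that are module and comodule morphisms. The edge slides are $D_b=S_{b^L}: a\otimes b\mapsto b_{(1)}a\otimes b_{(2)}$ and $D_a=S_{a^L}: a\otimes b\mapsto a_{(2)}\otimes bS(a_{(1)})$. $B_3=\langle A,B\mid ABA=BAB\rangle$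 and $\mathrm{SL}(2,\mathbb Z)=\langle A,B\mid (BAB)^4=1,\ ABA=BAB\rangle$. When $\mathcal C$ is finitely complete and cocomplete, $H^{\otimes2}_{inv}$ is the image of $\pi\circ\iota$, where $\iota:(H^{\otimes2})^{coH}\to H^{\otimes2}$ is the equaliser of $\delta_f$ and $\eta\otimes 1$ and $\pi:H^{\otimes2}\to(H^{\otimes2})^H$ the coequaliser of $\rhd_v$ and $\epsilon\otimes1$; Yetter-Drinfeld automorphisms induce automorphisms of $H^{\otimes2}_{inv}$. *)

(* Defs.v *)
From Stdlib Require Import List.
Import ListNotations.

Record SMCOps : Type := {
  Ob :> Type;
  Hom : Ob -> Ob -> Type;
  idm : forall A : Ob, Hom A A;
  comp : forall A B C : Ob, Hom B C -> Hom A B -> Hom A C;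
  tens : Ob -> Ob -> Ob;
  tensm : forall A B C D : Ob, Hom A B -> Hom C D -> Hom (tens A C) (tens B D);
  unitob : Ob;
  assoc : forall A B C : Ob, Hom (tens (tens A B) C) (tens A (tens B C));
  associ : forall A B C : Ob, Hom (tens A (tens B C)) (tens (tens A B) C);
  lunit : forall A : Ob, Hom (tens unitob A) A;
  luniti : forall A : Ob, Hom A (tens unitob A);
  runit : forall A : Ob, Hom (tens A unitob) A;
  runiti : forall A : Ob, Hom A (tens A unitob);
  braid : forall A B : Ob, Hom (tens A B) (tens B A)
}.

Arguments Hom {s} _ _.
Arguments idm {s} A.
Arguments comp {s A B C} _ _.
Arguments tens {s} _ _.
Arguments tensm {s A B C D} _ _.
Arguments unitob {s}.
Arguments assoc {s} A B C.
Arguments associ {s} A B C.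
Arguments lunit {s} A.
Arguments luniti {s} A.
Arguments runit {s} A.
Arguments runiti {s} A.
Arguments braid {s} A B.

Notation "g ∘ f" := (comp g f) (at level 40, left associativity).
Notation "f ⊠ g" := (tensm f g) (at level 30, right associativity).
Notation "A ⊗ B" := (tens A B) (at level 30, right associativity).

Record is_SMC (K : SMCOps) : Prop := {
  comp_assoc : forall (A B X D : K) (h : Hom X D) (g : Hom B X) (f : Hom A B),
    h ∘ (g ∘ f) = (h ∘ g) ∘ f;
  comp_idl : forall (A B : K) (f : Hom A B), idm B ∘ f = f;
  comp_idr : forall (A B : K) (f : Hom A B), f ∘ idm A = f;
  tens_id : forall (A B : K), idm A ⊠ idm B = idm (A ⊗ B);
  tens_comp : forall (A1 A2 A3 B1 B2 B3 : K) (f1 : Hom A1 A2) (f2 : Hom A2 A3)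
      (g1 : Hom B1 B2) (g2 : Hom B2 B3),
    (f2 ∘ f1) ⊠ (g2 ∘ g1) = (f2 ⊠ g2) ∘ (f1 ⊠ g1);
  assoc_iso1 : forall A B X : K, assoc A B X ∘ associ A B X = idm (A ⊗ (B ⊗ X));
  assoc_iso2 : forall A B X : K, associ A B X ∘ assoc A B X = idm ((A ⊗ B) ⊗ X);
  lunit_iso1 : forall A : K, lunit A ∘ luniti A = idm A;
  lunit_iso2 : forall A : K, luniti A ∘ lunit A = idm (unitob ⊗ A);
  runit_iso1 : forall A : K, runit A ∘ runiti A = idm A;
  runit_iso2 : forall A : K, runiti A ∘ runit A = idm (A ⊗ unitob);
  assoc_nat : forall (A A' B B' X X' : K) (f : Hom A A') (g : Hom B B') (h : Hom X X'),
    assoc A' B' X' ∘ ((f ⊠ g) ⊠ h) = (f ⊠ (g ⊠ h)) ∘ assoc A B X;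
  lunit_nat : forall (A B : K) (f : Hom A B), lunit B ∘ (idm unitob ⊠ f) = f ∘ lunit A;
  runit_nat : forall (A B : K) (f : Hom A B), runit B ∘ (f ⊠ idm unitob) = f ∘ runit A;
  pentagon : forall A B X D : K,
    assoc A B (X ⊗ D) ∘ assoc (A ⊗ B) X D
    = (idm A ⊠ assoc B X D) ∘ assoc A (B ⊗ X) D ∘ (assoc A B X ⊠ idm D);
  triangle : forall A B : K,
    (idm A ⊠ lunit B) ∘ assoc A unitob B = runit A ⊠ idm B;
  braid_nat : forall (A A' B B' : K) (f : Hom A A') (g : Hom B B'),
    braid A' B' ∘ (f ⊠ g) = (g ⊠ f) ∘ braid A B;
  braid_sym : forall A B : K, braid B A ∘ braid A B = idm (A ⊗ B);
  hexagon : forall A B X : K,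
    assoc B X A ∘ braid A (B ⊗ X) ∘ assoc A B X
    = (idm B ⊠ braid A X) ∘ assoc B A X ∘ (braid A B ⊠ idm X)
}.

Definition ms {K : SMCOps} (A B X D : K) : Hom ((A ⊗ B) ⊗ (X ⊗ D)) ((A ⊗ X) ⊗ (B ⊗ D)) :=
  associ A X (B ⊗ D) ∘ (idm A ⊠ (assoc X B D ∘ (braid B X ⊠ idm D) ∘ associ B X D))
  ∘ assoc A B (X ⊗ D).

Record is_Hopf {K : SMCOps} (H : K) (m : Hom (H ⊗ H) H) (u : Hom unitob H)
    (D : Hom H (H ⊗ H)) (e : Hom H unitob) (S : Hom H H) : Prop := {
  h_assoc : m ∘ (m ⊠ idm H) = m ∘ (idm H ⊠ m) ∘ assoc H H H;
  h_unitl : m ∘ (u ⊠ idm H) = lunit H;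
  h_unitr : m ∘ (idm H ⊠ u) = runit H;
  h_coassoc : assoc H H H ∘ (D ⊠ idm H) ∘ D = (idm H ⊠ D) ∘ D;
  h_counitl : (e ⊠ idm H) ∘ D = luniti H;
  h_counitr : (idm H ⊠ e) ∘ D = runiti H;
  h_Dm : D ∘ m = (m ⊠ m) ∘ ms H H H H ∘ (D ⊠ D);
  h_em : e ∘ m = lunit unitob ∘ (e ⊠ e);
  h_Du : D ∘ u = (u ⊠ u) ∘ luniti unitob;
  h_eu : e ∘ u = idm unitob;
  h_antil : m ∘ (S ⊠ idm H) ∘ D = u ∘ e;
  h_antir : m ∘ (idm H ⊠ S) ∘ D = u ∘ e
}.

Record is_pivotal {K : SMCOps} (H : K) (m : Hom (H ⊗ H) H)
    (D : Hom H (H ⊗ H)) (e : Hom H unitob) (S : Hom H H) (p : Hom unitob H) : Prop := {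
  piv_D : D ∘ p = (p ⊠ p) ∘ luniti unitob;
  piv_e : e ∘ p = idm unitob;
  piv_S2 : m ∘ (idm H ⊠ m) ∘ (idm H ⊠ ((S ∘ S) ⊠ S)) ∘ (p ⊠ (idm H ⊠ p))
           ∘ luniti (H ⊗ unitob) ∘ runiti H = idm H
}.

Section Torus.
Context {K : SMCOps} (H : K) (m : Hom (H ⊗ H) H) (u : Hom unitob H)
    (D : Hom H (H ⊗ H)) (e : Hom H unitob) (S : Hom H H) (p : Hom unitob H).

Definition Tpiv : Hom H H := m ∘ (p ⊠ S) ∘ luniti H.

Definition slide_b : Hom (H ⊗ H) (H ⊗ H) :=
  (m ⊠ idm H) ∘ (braid H H ⊠ idm H) ∘ associ H H H ∘ (idm H ⊠ D).

Definition slide_a : Hom (H ⊗ H) (H ⊗ H) :=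
  (idm H ⊠ m) ∘ (idm H ⊠ (idm H ⊠ S)) ∘ assoc H H H ∘ braid H (H ⊗ H)
  ∘ assoc H H H ∘ (D ⊠ idm H).

Definition conjm : Hom ((H ⊗ H) ⊗ H) H :=
  m ∘ (idm H ⊠ m) ∘ (idm H ⊠ (idm H ⊠ S)) ∘ (idm H ⊠ braid H H) ∘ assoc H H H.

Definition Phi4 : Hom H ((H ⊗ H) ⊗ (H ⊗ H)) :=
  (braid H H ⊠ braid H H) ∘ ms H H H H ∘ (D ⊠ D) ∘ D.

Definition rho_v : Hom (H ⊗ (H ⊗ H)) (H ⊗ H) :=
  (conjm ⊠ conjm) ∘ ms (H ⊗ H) (H ⊗ H) H H ∘ (Phi4 ⊠ idm (H ⊗ H)).

Definition Psi_a : Hom H ((H ⊗ H) ⊗ H) :=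
  (braid H H ⊠ idm H) ∘ associ H H H ∘ (idm H ⊠ braid H H) ∘ assoc H H H
  ∘ (D ⊠ idm H) ∘ D.

Definition Psi_b : Hom H ((H ⊗ H) ⊗ H) :=
  associ H H H ∘ (idm H ⊠ braid H H) ∘ assoc H H H ∘ (D ⊠ idm H) ∘ D.

Definition qmap : Hom ((H ⊗ H) ⊗ (H ⊗ H)) H :=
  m ∘ ((m ∘ (Tpiv ⊠ idm H)) ⊠ (m ∘ (idm H ⊠ Tpiv))) ∘ ms H H H H.

Definition delta_f : Hom (H ⊗ H) (H ⊗ (H ⊗ H)) :=
  (qmap ⊠ idm (H ⊗ H)) ∘ ms (H ⊗ H) H (H ⊗ H) H ∘ (Psi_a ⊠ Psi_b).

Definition triv_coact : Hom (H ⊗ H) (H ⊗ (H ⊗ H)) :=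
  (u ⊠ idm (H ⊗ H)) ∘ luniti (H ⊗ H).
Definition triv_act : Hom (H ⊗ (H ⊗ H)) (H ⊗ H) :=
  lunit (H ⊗ H) ∘ (e ⊠ idm (H ⊗ H)).

Definition is_YD_morphism (f : Hom (H ⊗ H) (H ⊗ H)) : Prop :=
  f ∘ rho_v = rho_v ∘ (idm H ⊠ f) /\ delta_f ∘ f = (idm H ⊠ f) ∘ delta_f.

End Torus.

Definition is_inverse {K : SMCOps} {X Y : K} (f : Hom X Y) (g : Hom Y X) : Prop :=
  g ∘ f = idm X /\ f ∘ g = idm Y.

Definition is_mono {K : SMCOps} {X Y : K} (j : Hom X Y) : Prop :=
  forall (Z : K) (f g : Hom Z X), j ∘ f = j ∘ g -> f = g.

Definition is_equaliser {K : SMCOps} {E X Y : K} (i : Hom E X) (f g : Hom X Y) : Prop :=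
  f ∘ i = g ∘ i /\
  forall (Z : K) (h : Hom Z X), f ∘ h = g ∘ h -> exists! k : Hom Z E, i ∘ k = h.

Definition is_coequaliser {K : SMCOps} {X Y Q : K} (q : Hom Y Q) (f g : Hom X Y) : Prop :=
  q ∘ f = q ∘ g /\
  forall (Z : K) (h : Hom Y Z), h ∘ f = h ∘ g -> exists! k : Hom Q Z, k ∘ q = h.

Definition is_image {K : SMCOps} {X M Y : K} (h : Hom X Y) (e : Hom X M) (j : Hom M Y) : Prop :=
  j ∘ e = h /\ is_mono j /\
  forall (M' : K) (e' : Hom X M') (j' : Hom M' Y),
    is_mono j' -> j' ∘ e' = h -> exists k : Hom M M', j' ∘ k = j.

Definition finitely_complete (K : SMCOps) : Prop :=
  (exists T : K, forall X : K, exists! f : Hom X T, True) /\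
  (forall A B : K, exists (P : K) (p1 : Hom P A) (p2 : Hom P B),
     forall (Z : K) (f : Hom Z A) (g : Hom Z B),
       exists! h : Hom Z P, p1 ∘ h = f /\ p2 ∘ h = g) /\
  (forall (X Y : K) (f g : Hom X Y), exists (E : K) (i : Hom E X), is_equaliser i f g).

Definition finitely_cocomplete (K : SMCOps) : Prop :=
  (exists I0 : K, forall X : K, exists! f : Hom I0 X, True) /\
  (forall A B : K, exists (P : K) (i1 : Hom A P) (i2 : Hom B P),
     forall (Z : K) (f : Hom A Z) (g : Hom B Z),
       exists! h : Hom P Z, h ∘ i1 = f /\ h ∘ i2 = g) /\
  (forall (X Y : K) (f g : Hom X Y), exists (Q : K) (q : Hom Y Q), is_coequaliser q f g).

Inductive gen := gA | gB.
(* a letter (x, false) is x, (x, true) is x^{-1} *)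
Definition word := list (gen * bool).

Inductive group_eq (rels : list (word * word)) : word -> word -> Prop :=
| ge_refl : forall w, group_eq rels w w
| ge_sym : forall w1 w2, group_eq rels w1 w2 -> group_eq rels w2 w1
| ge_trans : forall w1 w2 w3, group_eq rels w1 w2 -> group_eq rels w2 w3 -> group_eq rels w1 w3
| ge_cat : forall w1 w1' w2 w2', group_eq rels w1 w1' -> group_eq rels w2 w2' ->
    group_eq rels (w1 ++ w2) (w1' ++ w2')
| ge_cancel : forall x b, group_eq rels [(x, b); (x, negb b)] []
| ge_rel : forall r1 r2, In (r1, r2) rels -> group_eq rels r1 r2.

Definition wA : word := [(gA, false)].
Definition wB : word := [(gB, false)].

Definition B3_rels : list (word * word) := [(wA ++ wB ++ wA, wB ++ wA ++ wB)].

Definition SL2Z_rels : list (word * word) :=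
  [(wB ++ wA ++ wB ++ wB ++ wA ++ wB ++ wB ++ wA ++ wB ++ wB ++ wA ++ wB, []);
   (wA ++ wB ++ wA, wB ++ wA ++ wB)].

Definition eval_word {K : SMCOps} {X : K} (a ai b bi : Hom X X) (w : word) : Hom X X :=
  fold_right (fun l acc =>
    (match l with
     | (gA, false) => a | (gA, true) => ai
     | (gB, false) => b | (gB, true) => bi end) ∘ acc) (idm X) w.

Definition defines_hom {K : SMCOps} {X : K} (rels : list (word * word))
    (a ai b bi : Hom X X) : Prop :=
  is_inverse a ai /\ is_inverse b bi /\
  forall w1 w2, group_eq rels w1 w2 -> eval_word a ai b bi w1 = eval_word a ai b bi w2.

(* Main.v *)
(* Two composites of structure maps of a Hopf monoid are equal as soon as their Sweedler
   expressions agree. Such an expression is a list of input components together with one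
   word per output, in which every component occurs once. Post-composing with a structure
   map acts on expressions: a coproduct doubles every component occurring in a word, in
   the same order, and passes through the antipode with a flip. A component followed by
   the antipode of the next one cancels, and S^2 is conjugation by the pivotal element.
   Executing diagrams symbolically thus settles all equations needed here: the braid
   relation, the invertibility of the slides, their compatibility with action and
   coaction, and the identity (D_b D_a D_b)^4 = (T(x_(-1)) acting on x_(0)). By the last
   one (D_b D_a D_b)^4 becomes trivial on the image of the coinvariants in the quotient:
   on coinvariants x_(-1) = 1, and the action of T(1) = p is invisible in the quotient. *)
From Stdlib Require Import ssreflect ssrfun Arith Permutation Bool.
Require Import Defs.
From Stdlib Require Import List.
Import ListNotations.
Set Implicit Arguments.
Unset Strict Implicit.

(** * Formal diagrams and their symbolic execution *)

(** The category is not strict, and Sweedler components have to be carried through arbitrary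
    reshufflings, so most of the work lies in giving expressions a meaning. A list of names denotes
    a right-nested power of [H], and [perm] is the canonical map between two orderings of the same
    names; its functoriality and its compatibility with concatenation, braiding and coproducts
    replace a general coherence theorem. Names determine the intended permutation only when they are
    distinct: hence the [NoDup] conditions, which are tested during execution instead of being
    derived from a theory of fresh names. Formal diagrams form an instance of [SMCOps], so a slide
    built from formal maps denotes the actual slide by conversion, and each diagram identity becomes
    one closed boolean computation. The pivotal element enters twice: it inverts the antipode, which
    makes [slide_b] invertible, and it turns the squares S^2, which appear as soon as T is applied
    to a coaction that itself contains T, into letters of a word. *)

Inductive ty := tI | tX | tT (a b : ty).

Inductive dia : ty -> ty -> Type :=
| dId a : dia a a
| dComp a b c : dia b c -> dia a b -> dia a c
| dTens a b c d : dia a b -> dia c d -> dia (tT a c) (tT b d)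
| dAssoc a b c : dia (tT (tT a b) c) (tT a (tT b c))
| dAssoci a b c : dia (tT a (tT b c)) (tT (tT a b) c)
| dLunit a : dia (tT tI a) a
| dLuniti a : dia a (tT tI a)
| dRunit a : dia (tT a tI) a
| dRuniti a : dia a (tT a tI)
| dBraid a b : dia (tT a b) (tT b a)
| dM : dia (tT tX tX) tX
| dU : dia tI tX
| dD : dia tX (tT tX tX)
| dE : dia tX tI
| dS : dia tX tX
| dP : dia tI tX.

(* Formal diagrams are themselves SMC operations (without the laws), so that the
   constructions of [Defs] can be applied to them verbatim. *)
Definition Free : SMCOps :=
  {| Ob := ty; Hom := dia; idm := dId; comp := dComp; tens := tT;
     tensm := fun a b c d => @dTens a b c d; unitob := tI;
     assoc := dAssoc; associ := dAssoci; lunit := dLunit; luniti := dLuniti;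
     runit := dRunit; runiti := dRuniti; braid := dBraid |}.

Inductive term := Var (x : nat) | Antip (t : term) | Prod (t1 t2 : term) | One | Pivot.

Fixpoint term_vars (t : term) : list nat :=
  match t with
  | Var x => [x] | Antip t => term_vars t | Prod t1 t2 => term_vars t1 ++ term_vars t2 | One =>
      [] | Pivot => []
  end.

Fixpoint val (a : ty) : Type :=
  match a with tI => unit | tX => term | tT a b => (val a * val b)%type end.

Fixpoint vars (a : ty) : val a -> list nat :=
  match a with
  | tI => fun _ => []
  | tX => term_vars
  | tT a b => fun v => vars v.1 ++ vars v.2
  end.

(* The Sweedler components of each input, in order. *)
Fixpoint splitting (a : ty) : Type :=
  match a with tI => unit | tX => list nat | tT a b => (splitting a * splitting b)%type end.

Fixpoint names (a : ty) : splitting a -> list nat :=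
  match a with
  | tI => fun _ => []
  | tX => fun l => l
  | tT a b => fun s => names s.1 ++ names s.2
  end.

Fixpoint resplit_map (g : nat -> list nat) (a : ty) : splitting a -> splitting a :=
  match a with
  | tI => fun s => s
  | tX => flat_map g
  | tT a b => fun s => (resplit_map g s.1, resplit_map g s.2)
  end.

Fixpoint sfree (t : term) : bool :=
  match t with
  | Antip _ => false | Prod t1 t2 => sfree t1 && sfree t2 | _ => true
  end.

Fixpoint dup_term (N : nat) (t : term) : term * term :=
  match t with
  | Var x => (Var x, Var (x + N))
  | Antip t => let d := dup_term N t in (Antip d.2, Antip d.1)
  | Prod t1 t2 => let d1 := dup_term N t1 in let d2 := dup_term N t2 in
      (Prod d1.1 d2.1, Prod d1.2 d2.2)
  | One => (One, One)
  | Pivot => (Pivot, Pivot)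
  end.

Definition memb (x : nat) (l : list nat) : bool := existsb (Nat.eqb x) l.

Fixpoint nodupb (l : list nat) : bool :=
  match l with [] => true | x :: l => negb (memb x l) && nodupb l end.

Definition subst_on (l : list nat) (f : nat -> list nat) (x : nat) : list nat :=
  if memb x l then f x else [x].

(** The duplicate test turns freshness of the new names into a checked condition: a bad choice makes
    execution fail instead of making it unsound. *)
Definition resplit (c : ty) (f : nat -> list nat) (l : list nat) (s : splitting c) : option
    (splitting c) :=
  if nodupb (flat_map (subst_on l f) (names s)) then Some (resplit_map (subst_on l f) s) else
      None.

(** One shift serves all variables that are doubled together. The least suitable one keeps the unary
    names small; the default exceeds every used name and therefore always works. The choice is
    certified afterwards by the test in [resplit]. *)
Definition fresh_shift (l used : list nat) : nat :=
  let fresh N := forallb (fun x => negb (memb (x + N) used)) l in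
  match find fresh (seq 1 (list_max used)) with
  | Some N => N
  | None => Datatypes.S (list_max used)
  end.

Inductive letter := LV (inv : bool) (x : nat) | LP (inv : bool).

Definition term_of_letter (l : letter) : term :=
  match l with
  | LV false x => Var x | LV true x => Antip (Var x) | LP false => Pivot | LP true => Antip Pivot
  end.

Definition term_of_word (w : list letter) : term := fold_right
    (fun l t => Prod (term_of_letter l) t) One w.

(* [S (S x)] becomes [S p * x * p]. *)
Definition antip_letter (l : letter) : list letter :=
  match l with
  | LV false x => [LV true x]
  | LV true x => [LP true; LV false x; LP false]
  | LP b => [LP (negb b)]
  end.

Fixpoint antip_word (w : list letter) : list letter :=
  match w with [] => [] | l :: w => antip_word w ++ antip_letter l end.

(* The flag [fl] permits to use that [S] reverses products and coproducts. With
   [fl = false] execution is sound before this is known, and serves to prove it. *)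
Fixpoint word_of_term (fl : bool) (t : term) : option (list letter) :=
  match t with
  | Var x => Some [LV false x]
  | One => Some []
  | Pivot => Some [LP false]
  | Prod t1 t2 =>
      match word_of_term fl t1, word_of_term fl t2 with
      | Some w1, Some w2 => Some (w1 ++ w2)
      | _, _ => None
      end
  | Antip t =>
      match word_of_term fl t with
      | Some [LV false x] => Some [LV true x]
      | Some w => if fl then Some (antip_word w) else None
      | None => None
      end
  end.

(** Only p and its inverse S(p) are reduced freely. Cancelling variables also changes the splitting
    and is left to [try_cancel]. *)
Definition pcons (l : letter) (w : list letter) : list letter :=
  match l, w with
  | LP true, LP false :: w' => w'
  | LP false, LP true :: w' => w'
  | _, _ => l :: w
  end.
Definition reduce (w : list letter) : list letter := fold_right pcons [] w.

Fixpoint wval (a : ty) : Type :=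
  match a with tI => unit | tX => list letter | tT a b => (wval a * wval b)%type end.

Fixpoint val_of_words (a : ty) : wval a -> val a :=
  match a with
  | tI => fun v => v
  | tX => term_of_word
  | tT a b => fun v => (val_of_words v.1, val_of_words v.2)
  end.

Fixpoint words_of_val (fl : bool) (a : ty) : val a -> option (wval a) :=
  match a with
  | tI => fun v => Some v
  | tX => word_of_term fl
  | tT a b => fun v =>
      match words_of_val fl v.1, words_of_val fl v.2 with
      | Some w1, Some w2 => Some (w1, w2)
      | _, _ => None
      end
  end.

Fixpoint words_map (f : list letter -> list letter) (a : ty) : wval a -> wval a :=
  match a with
  | tI => fun v => v
  | tX => f
  | tT a b => fun v => (words_map f v.1, words_map f v.2)
  end.

(* For [x], [y] consecutive Sweedler components of the same input. The last two
   patterns come from [p * S (S y) = y * p]. *)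
Definition cancel_hd (fl : bool) (x y : nat) (w : list letter) : option (list letter) :=
  match w with
  | LV false x' :: LV true y' :: w' =>
      if Nat.eqb x x' && Nat.eqb y y' then Some w' else None
  | LV true x' :: LV false y' :: w' =>
      if Nat.eqb x x' && Nat.eqb y y' then Some w' else None
  | LV false y' :: LP false :: LV true x' :: w' =>
      if fl && Nat.eqb x x' && Nat.eqb y y' then Some (LP false :: w') else None
  | LV true y' :: LP true :: LV false x' :: w' =>
      if fl && Nat.eqb x x' && Nat.eqb y y' then Some (LP true :: w') else None
  | _ => None
  end.

Fixpoint cancel_w (fl : bool) (x y : nat) (w : list letter) : option (list letter) :=
  match cancel_hd fl x y w with
  | Some w' => Some w'
  | None =>
      match w with
      | [] => None
      | l :: w' => match cancel_w fl x y w' with Some w'' => Some (l :: w'') | None => None end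
      end
  end.

Fixpoint cancel (fl : bool) (x y : nat) (a : ty) : wval a -> option (wval a) :=
  match a with
  | tI => fun _ => None
  | tX => cancel_w fl x y
  | tT a b => fun v =>
      match cancel fl x y v.1 with
      | Some v1 => Some (v1, v.2)
      | None => match cancel fl x y v.2 with Some v2 => Some (v.1, v2) | None => None end
      end
  end.

Fixpoint adjacent (l : list nat) : list (nat * nat) :=
  match l with
  | x :: (y :: _) as l' => (x, y) :: adjacent l'
  | _ => []
  end.

Fixpoint adjacent_names (a : ty) : splitting a -> list (nat * nat) :=
  match a with
  | tI => fun _ => []
  | tX => adjacent
  | tT a b => fun s => adjacent_names s.1 ++ adjacent_names s.2
  end.

Lemma term_eq_dec (t t' : term) : {t = t'} + {t <> t'}.
Proof. decide equality. exact (Nat.eq_dec _ _). Defined.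

Definition pair_dec A B (dA : forall x y : A, {x = y} + {x <> y})
  (dB : forall x y : B, {x = y} + {x <> y}) (x y : A * B) : {x = y} + {x <> y}.
Proof. decide equality. Defined.

Definition unit_dec (x y : unit) : {x = y} + {x <> y}.
Proof. decide equality. Defined.

Fixpoint val_eq_dec (a : ty) : forall v w : val a, {v = w} + {v <> w} :=
  match a with
  | tI => unit_dec
  | tX => term_eq_dec
  | tT a b => pair_dec (val_eq_dec (a := a)) (val_eq_dec (a := b))
  end.

Fixpoint spt_eq_dec (a : ty) : forall v w : splitting a, {v = w} + {v <> w} :=
  match a with
  | tI => unit_dec
  | tX => list_eq_dec Nat.eq_dec
  | tT a b => pair_dec (spt_eq_dec (a := a)) (spt_eq_dec (a := b))
  end.

Definition decb (A : Prop) (d : {A} + {~ A}) : bool :=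
  match d with left _ => true | right _ => false end.

Definition merge_at (x y z : nat) : list nat := if Nat.eqb z x then [x; y] else [z].
Definition kill_at (x z : nat) : list nat := if Nat.eqb z x then [] else [z].

(** A cancellation is legitimate only if [x] and [y] are the two halves of one coproduct. This is
    tested by deleting [y], splitting [x] again and comparing with [s]. The counit left over by the
    antipode axiom then deletes [x] as well. *)
Fixpoint try_cancel (fl : bool) (c a : ty) (l : list (nat * nat)) (s : splitting c) (w : wval a) :
    option (splitting c * wval a) :=
  match l with
  | [] => None
  | (x, y) :: l =>
      match cancel fl x y w with
      | Some w' =>
          let s0 := resplit_map (kill_at y) s in
          if negb (Nat.eqb x y) && decb (spt_eq_dec (resplit_map (merge_at x y) s0) s)
             && nodupb (names (resplit_map (kill_at x) s0))
          then Some (resplit_map (kill_at x) s0, words_map reduce w')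
          else None
      | None => try_cancel fl l s w
      end
  end.

(** Each round deletes two names, so the number of names, which [normalize] passes, is enough
    fuel. *)
Fixpoint cancel_all (fuel : nat) (fl : bool) (c a : ty) (s : splitting c) (w : wval a) :
    splitting c * wval a :=
  match fuel with
  | 0 => (s, w)
  | Datatypes.S fuel =>
      match try_cancel fl (adjacent_names s) s w with
      | Some (s', w') => cancel_all fuel fl s' w'
      | None => (s, w)
      end
  end.

Definition normalize (fl : bool) (c a : ty) (s : splitting c) (v : val a) : splitting c * val a :=
  match words_of_val fl v with
  | Some w =>
      let '(s', w') := cancel_all (length (names s)) fl s (words_map reduce w) in
          (s', val_of_words w')
  | None => (s, v)
  end.

(** Normalising between the factors of a composite keeps later coproducts from doubling components
    that cancel anyway. Without [fl], a coproduct is executed only on terms free of the antipode. *)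
Fixpoint run (fl : bool) (c : ty) (a b : ty) (d : dia a b) :
    splitting c -> val a -> option (splitting c * val b) :=
  match d in dia a b return splitting c -> val a -> option (splitting c * val b) with
  | dId _ => fun s v => Some (s, v)
  | dComp d1 d2 => fun s v =>
      match run fl d2 s v with
      | Some (s', v') => let n := normalize fl s' v' in run fl d1 n.1 n.2
      | None => None
      end
  | dTens d1 d2 => fun s v =>
      match run fl d1 s v.1 with
      | Some (s', v1) =>
          match run fl d2 s' v.2 with
          | Some (s'', v2) => Some (s'', (v1, v2))
          | None => None
          end
      | None => None
      end
  | dAssoc _ _ _ => fun s v => Some (s, (v.1.1, (v.1.2, v.2)))
  | dAssoci _ _ _ => fun s v => Some (s, ((v.1, v.2.1), v.2.2))
  | dLunit _ => fun s v => Some (s, v.2)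
  | dLuniti _ => fun s v => Some (s, (tt, v))
  | dRunit _ => fun s v => Some (s, v.1)
  | dRuniti _ => fun s v => Some (s, (v, tt))
  | dBraid _ _ => fun s v => Some (s, (v.2, v.1))
  | dM => fun s v => Some (s, Prod v.1 v.2)
  | dU => fun s _ => Some (s, One)
  | dD => fun s t =>
      if fl || sfree t then
        let N := fresh_shift (term_vars t) (names s) in
        match resplit (fun x => [x; x + N]) (term_vars t) s with
        | Some s' => Some (s', dup_term N t)
        | None => None
        end
      else None
  | dE => fun s t =>
      match resplit (fun _ => []) (term_vars t) s with Some s' => Some (s', tt) | None => None end
  | dS => fun s t => Some (s, Antip t)
  | dP => fun s _ => Some (s, Pivot)
  end.

Fixpoint init (a : ty) (k : nat) : splitting a * val a * nat :=
  match a with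
  | tI => (tt, tt, k)
  | tX => ([k], Var k, k + 1)
  | tT a b =>
      let '(s1, v1, k1) := init a k in
      let '(s2, v2, k2) := init b k1 in ((s1, s2), (v1, v2), k2)
  end.

Fixpoint rename_term (r : nat -> nat) (t : term) : term :=
  match t with
  | Var x => Var (r x) | Antip t => Antip (rename_term r t) | Prod t1 t2 => Prod
      (rename_term r t1) (rename_term r t2)
  | One => One | Pivot => Pivot
  end.

Fixpoint rename_val (r : nat -> nat) (a : ty) : val a -> val a :=
  match a with
  | tI => fun v => v
  | tX => rename_term r
  | tT a b => fun v => (rename_val r v.1, rename_val r v.2)
  end.

Fixpoint table (l l' : list nat) (z : nat) : nat :=
  match l, l' with
  | x :: l, y :: l' => if Nat.eqb z x then y else table l l' z
  | _, _ => z
  end.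

(** Component names are bound, so results are compared up to renaming. The only candidate renaming
    is the one that matches the two splittings position by position. *)
Definition same (c a : ty) (s : splitting c) (v : val a) (s' : splitting c) (v' : val a) : bool :=
  let r := table (names s) (names s') in
  nodupb (names s')
  && decb (spt_eq_dec (resplit_map (fun x => [r x]) s) s')
  && decb (val_eq_dec (rename_val r v) v').

Definition exec (fl : bool) (a b : ty) (d : dia a b) : option (splitting a * val b) :=
  let '(s, v, _) := init a 0 in
  if nodupb (names s) then
    match run fl d s v with Some (s', v') => Some (normalize fl s' v') | None => None end
  else None.

Definition check (fl : bool) (a b : ty) (d d' : dia a b) : bool :=
  match exec fl d, exec fl d' with
  | Some (s, v), Some (s', v') => same s v s' v'
  | _, _ => false
  end.

(** * Coherence in a symmetric monoidal category *)

Section Structural.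
Context {K : SMCOps} (HK : is_SMC K).

Local Notation id_ := (idm _).

Lemma compA (A B X Y : K) (h : Hom X Y) (g : Hom B X) (f : Hom A B) :
  (h ∘ g) ∘ f = h ∘ (g ∘ f).
Proof. by rewrite (comp_assoc _ HK). Qed.
Lemma comp1f (A B : K) (f : Hom A B) : id_ ∘ f = f.
Proof. exact (comp_idl _ HK _ _ f). Qed.
Lemma compf1 (A B : K) (f : Hom A B) : f ∘ id_ = f.
Proof. exact (comp_idr _ HK _ _ f). Qed.
Lemma tens11 (A B : K) : idm A ⊠ idm B = idm (A ⊗ B).
Proof. exact (tens_id _ HK A B). Qed.
Lemma tens_fuse (A1 A2 A3 B1 B2 B3 : K) (f1 : Hom A1 A2) (f2 : Hom A2 A3)
    (g1 : Hom B1 B2) (g2 : Hom B2 B3) :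
  (f2 ⊠ g2) ∘ (f1 ⊠ g1) = (f2 ∘ f1) ⊠ (g2 ∘ g1).
Proof. by rewrite (tens_comp _ HK). Qed.

(* Compositions are kept nested to the right: [tailmn E] rewrites with an equation [E]
   between chains of [m] and [n] morphisms in front of an arbitrary tail. *)
Lemma tail20 (A B Z : K) (a : Hom B A) (b : Hom A B) (E : a ∘ b = id_) (z : Hom Z A) :
  a ∘ (b ∘ z) = z.
Proof. by move: (f_equal (fun k => k ∘ z) E); rewrite !compA ?comp1f. Qed.
Lemma tail21 (A B X Z : K) (a : Hom B X) (b : Hom A B) c (E : a ∘ b = c) (z : Hom Z A) :
  a ∘ (b ∘ z) = c ∘ z.
Proof. by move: (f_equal (fun k => k ∘ z) E); rewrite !compA ?comp1f. Qed.
Lemma tail22 (A B X Y Z : K) (a : Hom B X) (b : Hom A B) (c : Hom Y X) (d : Hom A Y)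
    (E : a ∘ b = c ∘ d) (z : Hom Z A) :
  a ∘ (b ∘ z) = c ∘ (d ∘ z).
Proof. by move: (f_equal (fun k => k ∘ z) E); rewrite !compA ?comp1f. Qed.
Lemma tail23 (A B X W Var Z : K) (a : Hom B X) (b : Hom A B)
    (c : Hom W X) (d : Hom Var W) (d' : Hom A Var) (E : a ∘ b = c ∘ (d ∘ d')) (z : Hom Z A) :
  a ∘ (b ∘ z) = c ∘ (d ∘ (d' ∘ z)).
Proof. by move: (f_equal (fun k => k ∘ z) E); rewrite !compA ?comp1f. Qed.
Lemma tail31 (A B X Y Z : K) (a : Hom X Y) (b : Hom B X) (b' : Hom A B)
    c (E : a ∘ (b ∘ b') = c) (z : Hom Z A) :
  a ∘ (b ∘ (b' ∘ z)) = c ∘ z.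
Proof. by move: (f_equal (fun k => k ∘ z) E); rewrite !compA ?comp1f. Qed.
Lemma tail32 (A B X Y W Z : K) (a : Hom X Y) (b : Hom B X) (b' : Hom A B)
    (c : Hom W Y) (d : Hom A W) (E : a ∘ (b ∘ b') = c ∘ d) (z : Hom Z A) :
  a ∘ (b ∘ (b' ∘ z)) = c ∘ (d ∘ z).
Proof. by move: (f_equal (fun k => k ∘ z) E); rewrite !compA ?comp1f. Qed.
Lemma tail33 (A B X Y W Var Z : K) (a : Hom X Y) (b : Hom B X) (b' : Hom A B)
    (c : Hom W Y) (d : Hom Var W) (d' : Hom A Var) (E : a ∘ (b ∘ b') = c ∘ (d ∘ d'))
        (z : Hom Z A) :
  a ∘ (b ∘ (b' ∘ z)) = c ∘ (d ∘ (d' ∘ z)).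
Proof. by move: (f_equal (fun k => k ∘ z) E); rewrite !compA ?comp1f. Qed.

Lemma tens_compl (A A' A'' B : K) (f : Hom A A') (g : Hom A' A'') :
  (g ∘ f) ⊠ idm B = (g ⊠ id_) ∘ (f ⊠ id_).
Proof. by rewrite tens_fuse comp1f. Qed.
Lemma tens_compr (A A' A'' B : K) (f : Hom A A') (g : Hom A' A'') :
  idm B ⊠ (g ∘ f) = (id_ ⊠ g) ∘ (id_ ⊠ f).
Proof. by rewrite tens_fuse comp1f. Qed.
Lemma tens_lr (A A' B B' : K) (f : Hom A A') (g : Hom B B') :
  f ⊠ g = (f ⊠ id_) ∘ (id_ ⊠ g).
Proof. by rewrite tens_fuse comp1f compf1. Qed.
Lemma tens_rl (A A' B B' : K) (f : Hom A A') (g : Hom B B') :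
  f ⊠ g = (id_ ⊠ g) ∘ (f ⊠ id_).
Proof. by rewrite tens_fuse comp1f compf1. Qed.

Lemma assocK (A B X : K) : assoc A B X ∘ associ A B X = id_.
Proof. exact (assoc_iso1 _ HK A B X). Qed.
Lemma associK (A B X : K) : associ A B X ∘ assoc A B X = id_.
Proof. exact (assoc_iso2 _ HK A B X). Qed.
Lemma lunitK (A : K) : lunit A ∘ luniti A = id_.
Proof. exact (lunit_iso1 _ HK A). Qed.
Lemma lunitiK (A : K) : luniti A ∘ lunit A = id_.
Proof. exact (lunit_iso2 _ HK A). Qed.
Lemma runitK (A : K) : runit A ∘ runiti A = id_.
Proof. exact (runit_iso1 _ HK A). Qed.
Lemma runitiK (A : K) : runiti A ∘ runit A = id_.
Proof. exact (runit_iso2 _ HK A). Qed.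
Lemma assoc_natural (A A' B B' X X' : K) (f : Hom A A') (g : Hom B B') (h : Hom X X') :
  assoc A' B' X' ∘ ((f ⊠ g) ⊠ h) = (f ⊠ (g ⊠ h)) ∘ assoc A B X.
Proof. exact (assoc_nat _ HK _ _ _ _ _ _ f g h). Qed.
Lemma lunit_natural (A B : K) (f : Hom A B) : lunit B ∘ (id_ ⊠ f) = f ∘ lunit A.
Proof. exact (lunit_nat _ HK _ _ f). Qed.
Lemma runit_natural (A B : K) (f : Hom A B) : runit B ∘ (f ⊠ id_) = f ∘ runit A.
Proof. exact (runit_nat _ HK _ _ f). Qed.
Lemma braid_natural (A A' B B' : K) (f : Hom A A') (g : Hom B B') :
  braid A' B' ∘ (f ⊠ g) = (g ⊠ f) ∘ braid A B.
Proof. exact (braid_nat _ HK _ _ _ _ f g). Qed.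
Lemma braidK (A B : K) : braid B A ∘ braid A B = id_.
Proof. exact (braid_sym _ HK A B). Qed.
Lemma pentagonE (A B X Y : K) :
  assoc A B (X ⊗ Y) ∘ assoc (A ⊗ B) X Y
  = (id_ ⊠ assoc B X Y) ∘ (assoc A (B ⊗ X) Y ∘ (assoc A B X ⊠ id_)).
Proof. by rewrite (pentagon _ HK) compA. Qed.
Lemma triangleE (A B : K) : (id_ ⊠ lunit B) ∘ assoc A unitob B = runit A ⊠ id_.
Proof. exact (triangle _ HK A B). Qed.
Lemma hexagonE (A B X : K) :
  assoc B X A ∘ (braid A (B ⊗ X) ∘ assoc A B X)
  = (id_ ⊠ braid A X) ∘ (assoc B A X ∘ (braid A B ⊠ id_)).
Proof. by rewrite -!compA (hexagon _ HK). Qed.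

Lemma split_epi_cancel (A B X : K) (r : Hom A B) (s : Hom B A) (f g : Hom B X) :
  r ∘ s = id_ -> f ∘ r = g ∘ r -> f = g.
Proof. by move=> E F; rewrite -(compf1 f) -(compf1 g) -E -!compA F. Qed.
Lemma split_mono_cancel (A B X : K) (r : Hom A B) (s : Hom B A) (f g : Hom X A) :
  s ∘ r = id_ -> r ∘ f = r ∘ g -> f = g.
Proof. by move=> E F; rewrite -(comp1f f) -(comp1f g) -E !compA F. Qed.

Lemma associ_natural (A A' B B' X X' : K) (f : Hom A A') (g : Hom B B') (h : Hom X X') :
  associ A' B' X' ∘ (f ⊠ (g ⊠ h)) = ((f ⊠ g) ⊠ h) ∘ associ A B X.
Proof.
  apply: (split_epi_cancel (assocK A B X)).
  by rewrite !compA associK compf1 -assoc_natural (tail20 (associK _ _ _)).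
Qed.
Lemma luniti_natural (A B : K) (f : Hom A B) : (id_ ⊠ f) ∘ luniti A = luniti B ∘ f.
Proof.
  apply: (split_epi_cancel (lunitK A)).
  by rewrite !compA lunitiK compf1 -lunit_natural (tail20 (lunitiK _)).
Qed.
Lemma runiti_natural (A B : K) (f : Hom A B) : (f ⊠ id_) ∘ runiti A = runiti B ∘ f.
Proof.
  apply: (split_epi_cancel (runitK A)).
  by rewrite !compA runitiK compf1 -runit_natural (tail20 (runitiK _)).
Qed.

Lemma tens_inverse (A B A' B' : K) (f : Hom A A') (f' : Hom A' A) (g : Hom B B') (g' : Hom B' B) :
  f ∘ f' = id_ -> g ∘ g' = id_ -> (f ⊠ g) ∘ (f' ⊠ g') = id_.
Proof. by move=> E F; rewrite tens_fuse E F tens11. Qed.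

(** The left unitor is natural and invertible, so tensoring with the unit is faithful. Identities
    between unitors can thus be proved with an extra unit factor, where pentagon and triangle
    apply. *)
Lemma unit_tens_inj (A B : K) (f g : Hom A B) : idm unitob ⊠ f = idm unitob ⊠ g -> f = g.
Proof.
  move=> E. apply: (split_epi_cancel (lunitK A)).
  by rewrite -!lunit_natural E.
Qed.

Lemma tens_unit_inj (A B : K) (f g : Hom A B) : f ⊠ idm unitob = g ⊠ idm unitob -> f = g.
Proof.
  move=> E. apply: (split_epi_cancel (runitK A)).
  by rewrite -!runit_natural E.
Qed.

(** Kelly's argument: after tensoring with the unit and composing with invertible associators, both
    sides agree by the pentagon and two triangles. *)
Lemma lunit_assoc (A B : K) : lunit (A ⊗ B) ∘ assoc unitob A B = lunit A ⊠ id_.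
Proof.
  apply: unit_tens_inj.
  rewrite tens_compr.
  apply: (split_epi_cancel (r := assoc unitob (unitob ⊗ A) B ∘ (assoc unitob unitob A ⊠ id_))
    (s := (associ unitob unitob A ⊠ id_) ∘ associ unitob (unitob ⊗ A) B)).
  { rewrite !compA (tail20 (tens_inverse (assocK _ _ _) (comp1f _))). exact: assocK. }
  rewrite !compA -pentagonE (tail21 (triangleE _ _)) -tens11 -assoc_natural.
  by rewrite (tail22 (eq_sym (assoc_natural _ _ _))) tens_fuse triangleE comp1f.
Qed.

Lemma runit_assoc (A B : K) : (id_ ⊠ runit B) ∘ assoc A B unitob = runit (A ⊗ B).
Proof.
  apply: tens_unit_inj. rewrite tens_compl -triangleE -tens11.
  apply: (split_mono_cancel (r := assoc A B unitob) (s := associ A B unitob)).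
  { exact: associK. }
  rewrite (tail22 (assoc_natural _ _ _)).
  rewrite (tail22 (assoc_natural _ _ _)) pentagonE. rewrite (tail21 (tens_fuse _ _ _ _))
      triangleE comp1f.
  done.
Qed.

Lemma lunit_runit : lunit (@unitob K) = runit unitob.
Proof.
  apply: tens_unit_inj. rewrite -triangleE -lunit_assoc.
  congr (_ ∘ _).
  apply: (split_mono_cancel (lunitiK unitob)).
  by rewrite lunit_natural.
Qed.

(** The hexagon with two unit objects, followed by a left unitor, gives the claim tensored with the
    unit and composed with an invertible braiding. *)
Lemma braid_unitr (A : K) : lunit A ∘ braid A unitob = runit A.
Proof.
  apply: tens_unit_inj.
  have E := hexagonE A unitob unitob.
  have : lunit (unitob ⊗ A) ∘ (assoc unitob unitob A ∘ (braid A (unitob ⊗ unitob) ∘ assoc A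
      unitob unitob))
    = lunit (unitob ⊗ A) ∘ ((id_ ⊠ braid A unitob) ∘ (assoc unitob A unitob ∘
        (braid A unitob ⊠ id_))).
  { by rewrite E. }
  rewrite (tail21 (lunit_assoc _ _)) (tail22 (lunit_natural _)) (tail21 (lunit_assoc _ _)).
  rewrite lunit_runit. rewrite (tail22 (eq_sym (braid_natural _ _))) -lunit_runit triangleE
      tens_fuse comp1f => F.
  symmetry. apply: (split_mono_cancel (braidK A unitob)). exact: F.
Qed.

Lemma braid_unitl (A : K) : runit A ∘ braid unitob A = lunit A.
Proof. by rewrite -braid_unitr compA braidK compf1. Qed.

(* Sealed, lest rewriting by associativity of composition unfold it. *)
Fact swap2_sealed (A B Z : K) : {f : Hom (A ⊗ (B ⊗ Z)) (B ⊗ (A ⊗ Z)) |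
  f = assoc B A Z ∘ ((braid A B ⊠ id_) ∘ associ A B Z)}.
Proof. by eexists. Qed.
Definition swap2 (A B Z : K) := proj1_sig (swap2_sealed A B Z).
Lemma swap2E (A B Z : K) :
  swap2 A B Z = assoc B A Z ∘ ((braid A B ⊠ id_) ∘ associ A B Z).
Proof. exact: proj2_sig (swap2_sealed A B Z). Qed.

Lemma swap2_natural (A A' B B' Z Z' : K) (f : Hom A A') (g : Hom B B') (h : Hom Z Z') :
  swap2 A' B' Z' ∘ (f ⊠ (g ⊠ h)) = (g ⊠ (f ⊠ h)) ∘ swap2 A B Z.
Proof.
  rewrite !swap2E !compA associ_natural (tail21 (tens_fuse _ _ _ _)) braid_natural comp1f
      -(compf1 h) -tens_fuse compf1.
  by rewrite !compA (tail22 (assoc_natural _ _ _)).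
Qed.

Lemma swap2K (A B Z : K) : swap2 B A Z ∘ swap2 A B Z = id_.
Proof.
  rewrite !swap2E !compA (tail20 (associK _ _ _)) (tail20
      (tens_inverse (braidK _ _) (comp1f _))). exact: assocK.
Qed.

(** The hexagon transported to right-nested products: [A] passes a pair by passing its two factors
    in turn. The pentagon accounts for the associators. *)
Lemma swap2_tensr (A B C Z : K) :
  assoc B C (A ⊗ Z) ∘ swap2 A (B ⊗ C) Z
  = (id_ ⊠ swap2 A C Z) ∘ (swap2 A B (C ⊗ Z) ∘ (id_ ⊠ assoc B C Z)).
Proof.
  rewrite !swap2E !compA !tens_compr.
  apply: (split_epi_cancel (r := assoc A (B ⊗ C) Z ∘ (assoc A B C ⊠ id_))
    (s := (associ A B C ⊠ id_) ∘ associ A (B ⊗ C) Z)).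
  { rewrite !compA (tail20 (tens_inverse (assocK _ _ _) (comp1f _))). exact: assocK. }
  rewrite !compA -pentagonE (tail20 (associK _ _ _)) (tail20 (associK _ _ _)).
  rewrite (tail23 (pentagonE _ _ _ _)).
  have -> : (id_ ⊠ associ A C Z) ∘ (assoc B A (C ⊗ Z) ∘
      ((braid A B ⊠ idm (C ⊗ Z)) ∘ assoc (A ⊗ B) C Z))
    = assoc B (A ⊗ C) Z ∘ ((assoc B A C ⊠ id_) ∘ ((braid A B ⊠ id_) ⊠ id_)).
  { rewrite -tens11 -assoc_natural (tail23 (pentagonE _ _ _ _)).
    by rewrite (tail20 (tens_inverse (comp1f _) (associK _ _ _))). }
  rewrite -(tail22 (assoc_natural _ _ _)).
  rewrite !tens_fuse !comp1f. by rewrite hexagonE.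
Qed.

Lemma swap2_tensl (A B C Z : K) :
  swap2 (A ⊗ B) C Z ∘ associ A B (C ⊗ Z)
  = (id_ ⊠ associ A B Z) ∘ (swap2 A C (B ⊗ Z) ∘ (id_ ⊠ swap2 B C Z)).
Proof.
  apply: (split_mono_cancel (r := assoc A B (C ⊗ Z) ∘ swap2 C (A ⊗ B) Z)
    (s := swap2 (A ⊗ B) C Z ∘ associ A B (C ⊗ Z))).
  { rewrite !compA (tail20 (associK _ _ _)).  exact: swap2K. }
  rewrite !compA (tail20 (swap2K _ _ _)) assocK.
  rewrite (tail23 (swap2_tensr _ _ _ _)).
  rewrite (tail20 (tens_inverse (comp1f _) (assocK _ _ _))) (tail20 (swap2K _ _ _)).
  by rewrite tens_fuse swap2K comp1f tens11.
Qed.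

(** Naturality of moving [A] past [B ⊗ C], applied to the braiding of [B] and [C]. *)
Lemma swap2_yang_baxter (A B C Z : K) :
  (id_ ⊠ swap2 A B Z) ∘ (swap2 A C (B ⊗ Z) ∘ (id_ ⊠ swap2 B C Z))
  = swap2 B C (A ⊗ Z) ∘ ((id_ ⊠ swap2 A C Z) ∘ swap2 A B (C ⊗ Z)).
Proof.
  have E : forall A B Z : K, (assoc B A Z) ∘ (braid A B ⊠ id_) = swap2 A B Z ∘ assoc A B Z.
  { move=> *. by rewrite !swap2E !compA associK compf1. }
  apply: (split_epi_cancel (r := id_ ⊠ assoc B C Z) (s := id_ ⊠ associ B C Z)).
  { exact: (tens_inverse (comp1f _) (assocK _ _ _)). }
  rewrite !compA -swap2_tensr -tens_compr -E tens_compr -(tail23 (swap2_tensr _ _ _ _)).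
  by rewrite swap2_natural tens11 (tail22 (E _ _ _)).
Qed.

(** Exchanging the first two factors ignores the bracketing of the others; this is a matter of
    pentagons only. *)
Lemma swap2_assoc (A B X Y : K) :
  (id_ ⊠ assoc A X Y) ∘ (assoc B (A ⊗ X) Y ∘ (swap2 A B X ⊠ id_))
  = swap2 A B (X ⊗ Y) ∘ ((id_ ⊠ assoc B X Y) ∘ assoc A (B ⊗ X) Y).
Proof.
  apply: (split_epi_cancel (r := assoc A B X ⊠ idm Y) (s := associ A B X ⊠ id_)).
  { exact: (tens_inverse (assocK _ _ _) (comp1f _)). }
  rewrite !compA -pentagonE !swap2E !compA (tail20 (associK _ _ _)) tens_fuse comp1f compA.
  rewrite compA associK compf1.
  rewrite tens_compl -(tail23 (pentagonE _ _ _ _)).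
  by rewrite assoc_natural tens11.
Qed.
Lemma braid_tens (A B X : K) :
  associ B X A ∘ ((id_ ⊠ braid A X) ∘ swap2 A B X) = braid A (B ⊗ X).
Proof.
  apply: (split_epi_cancel (assocK A B X)).
  rewrite swap2E !compA associK compf1 -hexagonE. by rewrite (tail20 (associK _ _ _)).
Qed.

(** * Named wires and their permutations *)

Section Wires.
Variable (H : K) (u : Hom unitob H) (e : Hom H unitob).

Fixpoint wires (G : list nat) : K :=
  match G with [] => unitob | _ :: G' => H ⊗ wires G' end.

Fixpoint remove1 (x : nat) (G : list nat) : list nat :=
  match G with
  | [] => []
  | y :: G' => match Nat.eq_dec x y with left _ => G' | right _ => y :: remove1 x G' end
  end.

(** The dependent match repeats the one in [remove1], so that both codomains compute together. A
    name that is absent gets a wire created by [u], a junk value. *)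
Fixpoint pull (x : nat) (G : list nat) : Hom (wires G) (H ⊗ wires (remove1 x G)) :=
  match G with
  | [] => (u ⊠ id_) ∘ luniti _
  | y :: G' =>
      match Nat.eq_dec x y as d return
        Hom (wires (y :: G')) (H ⊗ wires (match d with left _ => G' | right _ => y :: remove1 x
            G' end))
      with
      | left _ => idm (H ⊗ wires G')
      | right _ => swap2 H H (wires (remove1 x G')) ∘ (id_ ⊠ pull x G')
      end
  end.

Fixpoint discard (G : list nat) : Hom (wires G) unitob :=
  match G with
  | [] => idm unitob
  | _ :: G' => lunit _ ∘ (e ⊠ discard G')
  end.

(* The canonical rearrangement of named wires. On lists that are not permutations
   of one another it takes junk values, built from [u] and [e]; being total it also
   plays the role of a cast between [wires G] and [wires G'] when [G = G']. *)
Fixpoint perm (G G' : list nat) : Hom (wires G) (wires G') :=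
  match G' with
  | [] => discard G
  | x :: G1 => (id_ ⊠ perm (remove1 x G) G1) ∘ pull x G
  end.

Lemma permE G x G' : perm G (x :: G') = (id_ ⊠ perm (remove1 x G) G') ∘ pull x G.
Proof. by []. Qed.
Arguments perm : simpl never.

Lemma remove1_hd x G : remove1 x (x :: G) = G.
Proof. by move=> /=; case: Nat.eq_dec. Qed.
Lemma remove1_tl x y G : x <> y -> remove1 x (y :: G) = y :: remove1 x G.
Proof. by move=> /=; case: Nat.eq_dec. Qed.

Lemma perm_cons_same x G G' : perm (x :: G) (x :: G') = id_ ⊠ perm G G'.
Proof. by rewrite permE /=; case: Nat.eq_dec => // E; rewrite compf1. Qed.

Lemma perm_id G : perm G G = id_.
Proof. elim: G => [//|x G IH]. by rewrite perm_cons_same IH tens11. Qed.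

Lemma perm_eq A B C : A = B -> perm B C ∘ perm A B = perm A C.
Proof. by move=> ->; rewrite perm_id compf1. Qed.

Lemma remove1_comm x y G : remove1 x (remove1 y G) = remove1 y (remove1 x G).
Proof.
  elim: G => [//|z G IH].
  case: (Nat.eq_dec x y) => [->//|N].
  case: (Nat.eq_dec x z) => [E|Nx]; case: (Nat.eq_dec y z) => [E'|Ny].
  - congruence.
  - subst z. by rewrite remove1_hd (remove1_tl _ Ny) remove1_hd.
  - subst z. by rewrite remove1_hd (remove1_tl _ Nx) remove1_hd.
  - by rewrite (remove1_tl _ Nx) (remove1_tl _ Ny) !remove1_tl // IH.
Qed.

(** When a third wire heads the list, this is the Yang-Baxter relation. The inner [perm] is only a
    cast along [remove1_comm]. *)
Lemma pull_pull x y G : x <> y -> In x G -> In y G ->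
  swap2 H H _ ∘ ((id_ ⊠ pull x (remove1 y G)) ∘ pull y G)
  = (id_ ⊠ ((id_ ⊠ perm (remove1 y (remove1 x G)) (remove1 x (remove1 y G))) ∘ pull y
      (remove1 x G))) ∘ pull x G.
Proof.
  move=> N. elim: G => [//|z G IH] Ix Iy.
  move: (remove1_comm x y (z :: G)) => /=.
  case: (Nat.eq_dec y z) => [E'|Ny]; case: (Nat.eq_dec x z) => [E|Nx] /=.
  - congruence.
  - case: Nat.eq_dec => // _ _. by rewrite perm_id tens11 !compf1 tens11 comp1f.
  - case: Nat.eq_dec => // _ _. by rewrite perm_id !tens11 ?compf1 ?comp1f
      (tail20 (swap2K _ _ _)).
  - case: Nat.eq_dec => // _; case: Nat.eq_dec => // _ Er.
    have {}IH : swap2 H H (wires (remove1 x (remove1 y G))) ∘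
        (id_ ⊠ pull x (remove1 y G) ∘ pull y G)
      = (id_ ⊠ ((id_ ⊠ perm (remove1 y (remove1 x G)) (remove1 x (remove1 y G))) ∘ pull y
          (remove1 x G))) ∘ pull x G.
    { by apply: IH; [case: Ix => [F|]|case: Iy => [F|]] => //; [case: Nx|case: Ny]. }
    rewrite perm_cons_same !tens_compr !compA.
    rewrite -(tail22 (swap2_natural _ _ (pull x (remove1 y G))))
        -(tail33 (swap2_yang_baxter _ _ _ _)).
    rewrite -!tens_compr IH. rewrite !tens_compr !compA.
    rewrite (tail22 (swap2_natural _ _ (id_ ⊠ perm _ _)))
        (tail22 (swap2_natural _ _ (pull y (remove1 x G)))).
    have X : forall Z Z' (f : Hom Z Z'), (idm H ⊠ swap2 H H Z') ∘ (id_ ⊠ (id_ ⊠ (id_ ⊠ f)))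
      = (id_ ⊠ (id_ ⊠ (id_ ⊠ f))) ∘ (id_ ⊠ swap2 H H Z).
    { move=> *; by rewrite -!tens_compr swap2_natural. }
    by rewrite (tail22 (X _ _ (perm _ _))).
Qed.
Lemma remove1_Permutation x G : In x G -> Permutation G (x :: remove1 x G).
Proof.
  elim: G => [//|y G IH] I. case: (Nat.eq_dec x y) => [->|N]; first by rewrite remove1_hd.
  rewrite (remove1_tl _ N) perm_swap -IH //. case: I => // F; by case: N.
Qed.

Lemma Permutation_remove1 x G G' : Permutation G (x :: G') -> Permutation (remove1 x G) G'.
Proof.
  move=> P. apply: (Permutation_cons_inv (a := x)). rewrite -P. symmetry.
  apply: remove1_Permutation. rewrite P. by left.
Qed.

Lemma remove1_app x G1 G2 : In x G1 -> remove1 x (G1 ++ G2) = remove1 x G1 ++ G2.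
Proof.
  elim: G1 => [//|y G IH] I. case: (Nat.eq_dec x y) => [->|N]; first by rewrite -app_comm_cons
      !remove1_hd.
  rewrite -app_comm_cons !(remove1_tl _ N) -app_comm_cons IH //. case: I => // F; by case: N.
Qed.

Lemma pull_perm x G G' : Permutation G G' -> In x G' ->
  pull x G' ∘ perm G G' = (id_ ⊠ perm (remove1 x G) (remove1 x G')) ∘ pull x G.
Proof.
  elim: G' G => [//|y G' IH] G P I.
  have IyG : In y G by rewrite P; left.
  have IxG : In x G by rewrite P.
  rewrite permE /=. case: Nat.eq_dec => [E|N]; first by rewrite comp1f E.
  have I' : In x G' by case: I => // F; case: N.
  have P' := Permutation_remove1 P.
  rewrite !compA (tail21 (tens_fuse _ _ _ _)) comp1f (IH _ P' I') tens_compr !compA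
      (tail22 (swap2_natural _ _ _)) (pull_pull N) //.
  by rewrite (tail21 (tens_fuse _ _ _ _)) comp1f permE (tail21 (tens_fuse _ _ _ _)) comp1f
      perm_eq // remove1_comm.
Qed.

(** Coherence in usable form: a composite of canonical maps depends only on its two ends. Repeated
    names do no harm here, since [pull] consistently takes the first occurrence. *)
Lemma perm_comp A B C : Permutation A B -> Permutation B C ->
  perm B C ∘ perm A B = perm A C.
Proof.
  elim: C A B => [|x C IH] A B PA PB.
  - move/Permutation_sym/Permutation_nil: PB => E; subst B.
    move/Permutation_sym/Permutation_nil: PA => E; subst A. by rewrite perm_id comp1f.
  - have Ix : In x B by rewrite PB; left.
    rewrite !permE !compA pull_perm // (tail21 (tens_fuse _ _ _ _)) comp1f IH //; last by apply:
        Permutation_remove1.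
    apply: Permutation_remove1. rewrite PA. exact: remove1_Permutation.
Qed.

Fixpoint cut (G1 G2 : list nat) : Hom (wires (G1 ++ G2)) (wires G1 ⊗ wires G2) :=
  match G1 with
  | [] => luniti (wires G2)
  | _ :: G1' => associ H (wires G1') (wires G2) ∘ (id_ ⊠ cut G1' G2)
  end.

Fixpoint glue (G1 G2 : list nat) : Hom (wires G1 ⊗ wires G2) (wires (G1 ++ G2)) :=
  match G1 with
  | [] => lunit (wires G2)
  | _ :: G1' => (id_ ⊠ glue G1' G2) ∘ assoc H (wires G1') (wires G2)
  end.

Lemma cut_cons x G1 G2 : cut (x :: G1) G2 = associ H (wires G1) (wires G2) ∘ (id_ ⊠ cut G1 G2).
Proof. by []. Qed.

Lemma glue_cut G1 G2 : glue G1 G2 ∘ cut G1 G2 = id_.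
Proof.
  elim: G1 => [|x G1 IH] /=; first exact: lunitK.
  by rewrite !compA (tail20 (assocK _ _ _)) tens_fuse IH comp1f tens11.
Qed.

Lemma cut_glue G1 G2 : cut G1 G2 ∘ glue G1 G2 = id_.
Proof.
  elim: G1 => [|x G1 IH] /=; first exact: lunitiK.
  by rewrite !compA (tail21 (tens_fuse _ _ _ _)) IH comp1f tens11 comp1f associK.
Qed.

Lemma pull_app x G1 G2 : In x G1 ->
  (id_ ⊠ (cut (remove1 x G1) G2 ∘ perm (remove1 x (G1 ++ G2)) (remove1 x G1 ++ G2))) ∘ pull x
      (G1 ++ G2)
  = assoc _ _ _ ∘ ((pull x G1 ⊠ id_) ∘ cut G1 G2).
Proof.
  elim: G1 => [//|y G1 IH] I.
  change ((y :: G1) ++ G2) with (y :: (G1 ++ G2)). rewrite cut_cons.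
  case: (Nat.eq_dec x y) => [E|N].
  - subst y => /=. case: Nat.eq_dec => // _.
    by rewrite perm_id !compf1 tens11 comp1f (tail20 (assocK _ _ _)).
  - have I' : In x G1 by case: I => // F; case: N.
    move: (IH I') => /= {}IH. case: Nat.eq_dec => // _ /=.
    rewrite perm_cons_same !tens_compr !compA !tens_compl !compA.
    rewrite -(tail22 (swap2_natural _ _ (perm _ _))) -(tail22 (swap2_natural _ _ (cut _ _)))
        -!tens_compr.
    rewrite !tens_compr !compA in IH. rewrite IH.
    apply: (split_mono_cancel (s := id_ ⊠ associ _ _ _) (r := id_ ⊠ assoc _ _ _)).
    { exact: (tens_inverse (comp1f _) (associK _ _ _)). }
    rewrite (tail20 (tens_inverse (comp1f _) (assocK _ _ _))).
    rewrite (tail33 (swap2_assoc _ _ _ _)).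
    rewrite (tail22 (assoc_natural _ _ _)) (tail20 (assocK _ _ _)). by rewrite !tens_compr.
Qed.

Lemma perm_app G1 G2 G1' G2' : Permutation G1 G1' -> Permutation G2 G2' ->
  cut G1' G2' ∘ perm (G1 ++ G2) (G1' ++ G2') = (perm G1 G1' ⊠ perm G2 G2') ∘ cut G1 G2.
Proof.
  move=> P1 P2. elim: G1' G1 P1 => [|x G1' IH] G1 P1.
  - move/Permutation_sym/Permutation_nil: P1 => -> /=. by rewrite perm_id luniti_natural.
  - have I : In x G1 by rewrite P1; left.
    have P := Permutation_remove1 P1.
    change ((x :: G1') ++ G2') with (x :: (G1' ++ G2')). rewrite cut_cons !permE.
    rewrite -(perm_eq (A := remove1 x (G1 ++ G2)) _ (remove1_app _ I)) !compA.
    rewrite (tail21 (tens_fuse _ _ _ _)) comp1f (tail21 (IH _ P)) ?compA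
        ?(tail21 (tens_fuse _ _ _ _)) ?comp1f ?compA (tens_compr _ _ (perm _ _ ⊠ perm _ _))
        !compA pull_app //.
    by rewrite -(tail22 (assoc_natural _ _ _)) (tail20 (associK _ _ _))
        (tail21 (tens_fuse _ _ _ _)) compf1.
Qed.

Lemma swap2_unit (Z : K) : swap2 unitob H Z ∘ luniti (H ⊗ Z) = id_ ⊠ luniti Z.
Proof.
  have E : associ unitob H Z ∘ luniti (H ⊗ Z) = luniti H ⊠ id_.
  { apply: (split_epi_cancel (r := lunit H ⊠ id_) (s := luniti H ⊠ id_)).
    - exact: (tens_inverse (lunitK _) (comp1f _)).
    - rewrite (tens_inverse (lunitiK _) (comp1f _)) -lunit_assoc !compA (tail20 (lunitiK _)).
        exact: associK. }
  rewrite swap2E !compA E tens_fuse comp1f.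
  apply: (split_mono_cancel (r := id_ ⊠ lunit Z) (s := id_ ⊠ luniti Z)).
  { exact: (tens_inverse (comp1f _) (lunitiK _)). }
  rewrite (tail21 (triangleE _ _)) !tens_fuse lunitK !comp1f -compA braid_unitl lunitK. done.
Qed.

Lemma perm_swap2 x y G : x <> y -> perm (y :: x :: G) (x :: y :: G) = swap2 H H (wires G).
Proof.
  move=> N. rewrite permE /=. case: Nat.eq_dec => // _. case: Nat.eq_dec => // _.
  by rewrite perm_id !tens11 comp1f compf1.
Qed.

Lemma perm_middle x G1 G2 : ~ In x G1 ->
  (id_ ⊠ cut G1 G2) ∘ perm (G1 ++ x :: G2) (x :: G1 ++ G2)
  = swap2 (wires G1) H (wires G2) ∘ cut G1 (x :: G2).
Proof.
  elim: G1 => [|y G1 IH] I.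
  - by rewrite /= perm_id compf1 swap2_unit.
  - have N : x <> y by move=> F; apply: I; left.
    have I' : ~ In x G1 by move=> F; apply: I; right.
    change (perm ((y :: G1) ++ x :: G2) (x :: (y :: G1) ++ G2))
      with (perm (y :: G1 ++ x :: G2) (x :: y :: G1 ++ G2)).
    rewrite -(perm_comp (B := y :: x :: G1 ++ G2)).
    + constructor. symmetry. exact: Permutation_middle.
    + constructor.
    + rewrite perm_swap2 // perm_cons_same cut_cons tens_compr !compA.
      rewrite -(tail22 (swap2_natural _ _ _)) -tens_compr IH // tens_compr cut_cons
          (tail23 (swap2_tensl _ _ _ _)).
      done.
Qed.

Lemma cut_nilr G : runit _ ∘ cut G [] = perm (G ++ []) G.
Proof.
  elim: G => [|x G IH]; first by rewrite /= perm_id -lunit_runit lunitK.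
  change ((x :: G) ++ []) with (x :: (G ++ [])). rewrite perm_cons_same cut_cons -IH tens_compr
      -runit_assoc.
  by rewrite !compA (tail20 (assocK _ _ _)).
Qed.

(** The wires of [G2] cross the block [G1] one at a time. Distinct names matter: for [G1 = G2 = [x]]
    the canonical map is the identity and not the exchange. *)
Lemma perm_braid G1 G2 : NoDup (G1 ++ G2) ->
  braid _ _ ∘ cut G1 G2 = cut G2 G1 ∘ perm (G1 ++ G2) (G2 ++ G1).
Proof.
  elim: G2 => [|x G2 IH] N.
  - rewrite /= -cut_nilr -braid_unitr !compA. by rewrite (tail20 (lunitiK _)).
  - have I : ~ In x G1.
    { move=> F; apply: (NoDup_remove_2 _ _ _ N); apply/in_or_app; by left. }
    change ((x :: G2) ++ G1) with (x :: (G2 ++ G1)). rewrite -(perm_comp (B := x :: G1 ++ G2)).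
    + symmetry. exact: Permutation_middle.
    + constructor. exact: Permutation_app_comm.
    + rewrite perm_cons_same cut_cons !compA (tail21 (tens_fuse _ _ _ _)) comp1f
        -(IH (NoDup_remove_1 _ _ _ N)).
      by rewrite tens_compr !compA perm_middle // (tail31 (braid_tens _ _ _)).
Qed.

(** The [perm] is a cast along associativity of concatenation; the induction step is the
    pentagon. *)
Lemma cut_assoc G1 G2 G3 :
  assoc _ _ _ ∘ ((cut G1 G2 ⊠ id_) ∘ cut (G1 ++ G2) G3)
  = (id_ ⊠ cut G2 G3) ∘ (cut G1 (G2 ++ G3) ∘ perm ((G1 ++ G2) ++ G3) (G1 ++ G2 ++ G3)).
Proof.
  elim: G1 => [|x G1 IH].
  - rewrite /= perm_id compf1 luniti_natural.
    apply: (split_mono_cancel (r := lunit (wires G2 ⊗ wires G3)) (s := luniti _)).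
    { exact: lunitiK. }
    rewrite (tail21 (lunit_assoc _ _)) (tail20 (lunitK _)).
    by rewrite -compA tens_fuse lunitK comp1f tens11 comp1f.
  - change (cut ((x :: G1) ++ G2) G3) with (cut (x :: (G1 ++ G2)) G3).
    change (perm (((x :: G1) ++ G2) ++ G3) ((x :: G1) ++ G2 ++ G3))
      with (perm (x :: ((G1 ++ G2) ++ G3)) (x :: (G1 ++ G2 ++ G3))).
    rewrite !cut_cons perm_cons_same !compA.
    have X Z Z' (f : Hom Z Z') : (idm (wires (x :: G1)) ⊠ f) ∘ associ H (wires G1) Z
      = associ H (wires G1) Z' ∘ (id_ ⊠ (id_ ⊠ f)).
    { by rewrite associ_natural tens11. }
    rewrite (tail22 (X _ _ _)) -!tens_compr -IH !tens_compr tens_compl !compA.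
    apply: (split_mono_cancel (r := assoc _ _ _) (s := associ _ _ _)).
    { exact: associK. }
    rewrite (tail20 (assocK _ _ _)) (tail23 (pentagonE _ _ _ _))
        (tail20 (tens_inverse (assocK _ _ _) (comp1f _))).
    by rewrite (tail22 (assoc_natural _ _ _)) (tail20 (assocK _ _ _)).
Qed.

(** * Iterated coproducts *)

Variables (m : Hom (H ⊗ H) H) (D : Hom H (H ⊗ H)) (S : Hom H H) (p : Hom unitob H).
Hypothesis HH : is_Hopf H m u D e S.

(** Only the length of [l] affects the morphism; the names label its outputs. Ending with the counit
    treats deletion, renaming and doubling of a component uniformly, as lists of length 0, 1 and
    2. *)
Fixpoint icop (l : list nat) : Hom H (wires l) :=
  match l with [] => e | _ :: l' => (id_ ⊠ icop l') ∘ D end.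

Fixpoint split_wires (g : nat -> list nat) (G : list nat) : Hom (wires G) (wires (flat_map g G))
    :=
  match G with
  | [] => id_
  | x :: G' => glue (g x) (flat_map g G') ∘ (icop (g x) ⊠ split_wires g G')
  end.

Lemma split_wires_cons g x G :
  split_wires g (x :: G) = glue (g x) (flat_map g G) ∘ (icop (g x) ⊠ split_wires g G).
Proof. by []. Qed.

Lemma coassociative : assoc H H H ∘ ((D ⊠ id_) ∘ D) = (id_ ⊠ D) ∘ D.
Proof. by rewrite -compA (h_coassoc _ _ _ _ _ _ HH). Qed.

(** General coassociativity; the empty list contributes counitality. *)
Lemma icop_app l1 l2 : icop (l1 ++ l2) = glue l1 l2 ∘ ((icop l1 ⊠ icop l2) ∘ D).
Proof.
  elim: l1 => [|x l1 IH] /=.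
  - by rewrite (tens_rl e) compA (h_counitl _ _ _ _ _ _ HH) (tail22 (lunit_natural _)) lunitK
      compf1.
  - have -> : ((id_ ⊠ icop l1) ∘ D) ⊠ icop l2 = ((id_ ⊠ icop l1) ⊠ icop l2) ∘ (D ⊠ id_).
    { by rewrite tens_fuse compf1. }
    by rewrite IH !compA (tail22 (assoc_natural _ _ _)) coassociative !tens_compr !compA.
Qed.

Lemma split_wires_icop g l : split_wires g l ∘ icop l = icop (flat_map g l).
Proof.
  elim: l => [|x l IH] /=; first exact: comp1f.
  by rewrite icop_app !compA (tail21 (tens_fuse _ _ _ _)) compf1 IH.
Qed.

Lemma perm_glue G1 G2 G1' G2' : Permutation G1 G1' -> Permutation G2 G2' ->
  perm (G1 ++ G2) (G1' ++ G2') ∘ glue G1 G2 = glue G1' G2' ∘ (perm G1 G1' ⊠ perm G2 G2').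
Proof.
  move=> P1 P2.
  apply: (split_mono_cancel (glue_cut G1' G2')).
  rewrite (tail22 (perm_app P1 P2)) cut_glue compf1. by rewrite (tail20 (cut_glue _ _)).
Qed.

Lemma perm_inv A B : Permutation A B -> perm B A ∘ perm A B = id_.
Proof. move=> P. rewrite perm_comp ?perm_id //. by symmetry. Qed.

Lemma cut_assoc_inv G1 G2 G3 :
  cut (G1 ++ G2) G3 ∘ perm (G1 ++ G2 ++ G3) ((G1 ++ G2) ++ G3)
  = (glue G1 G2 ⊠ id_) ∘ (associ _ _ _ ∘ ((id_ ⊠ cut G2 G3) ∘ cut G1 (G2 ++ G3))).
Proof.
  apply: (split_mono_cancel (r := assoc _ _ _ ∘ (cut G1 G2 ⊠ id_))
    (s := (glue G1 G2 ⊠ id_) ∘ associ _ _ _)).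
  { rewrite !compA (tail20 (associK _ _ _)). exact: (tens_inverse (glue_cut _ _) (comp1f _)). }
  rewrite !compA (tail20 (tens_inverse (cut_glue _ _) (comp1f _))) (tail20 (assocK _ _ _)).
  rewrite -(compA (cut G1 G2 ⊠ id_)) -(compA (assoc _ _ _)) cut_assoc !compA perm_inv ?compf1 //.
  by rewrite app_assoc.
Qed.

Lemma split_wires_app g G1 G2 :
  cut (flat_map g G1) (flat_map g G2)
    ∘ (perm (flat_map g (G1 ++ G2)) (flat_map g G1 ++ flat_map g G2) ∘ split_wires g (G1 ++ G2))
  = (split_wires g G1 ⊠ split_wires g G2) ∘ cut G1 G2.
Proof.
  elim: G1 => [|x G1 IH]; first by rewrite /= perm_id comp1f -luniti_natural.
  change ((x :: G1) ++ G2) with (x :: (G1 ++ G2)).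
  rewrite !split_wires_cons cut_cons.
  change (flat_map g (x :: ?A)) with (g x ++ flat_map g A).
  have E := flat_map_app g G1 G2.
  rewrite -(perm_comp (B := g x ++ flat_map g G1 ++ flat_map g G2)).
  - by rewrite E.
  - by rewrite app_assoc.
  - have PE : Permutation (flat_map g (G1 ++ G2)) (flat_map g G1 ++ flat_map g G2) by rewrite E.
    rewrite !compA (tail22 (perm_glue (Permutation_refl (g x)) PE)) perm_id tens_fuse comp1f.
    rewrite -(compA (cut _ _)) cut_assoc_inv !compA (tail20 (cut_glue _ _)) tens_fuse comp1f IH.
    have -> : (glue (g x) (flat_map g G1) ∘ (icop (g x) ⊠ split_wires g G1)) ⊠ split_wires g G2
      = (glue (g x) (flat_map g G1) ⊠ id_) ∘ ((icop (g x) ⊠ split_wires g G1) ⊠ split_wires g G2).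
    { by rewrite tens_fuse comp1f. }
    by rewrite !compA -(tail22 (associ_natural _ _ _)) tens_fuse compf1.
Qed.

(** This is [perm_braid] with the wires of [R] as spectators; on right-nested blocks the braiding
    becomes [swap2]. *)
Lemma perm_swap_blocks X Y R : NoDup (Y ++ X) ->
  (id_ ⊠ cut Y R) ∘ (cut X (Y ++ R) ∘ perm (Y ++ X ++ R) (X ++ Y ++ R))
  = swap2 _ _ _ ∘ ((id_ ⊠ cut X R) ∘ cut Y (X ++ R)).
Proof.
  move=> N.
  have PYX := Permutation_app_comm Y X.
  rewrite -(perm_comp (B := (Y ++ X) ++ R)); first by rewrite app_assoc.
  { rewrite (app_assoc X). exact: Permutation_app_tail. }
  rewrite -(perm_comp (B := (X ++ Y) ++ R)); first exact: Permutation_app_tail.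
  { by rewrite app_assoc. }
  rewrite !compA -(compA (cut X (Y ++ R))) -(compA (id_ ⊠ cut Y R)) -cut_assoc !compA.
  rewrite (tail22 (perm_app PYX (Permutation_refl R))) perm_id.
  rewrite (tail21 (tens_fuse _ _ _ _)) -(perm_braid N) comp1f cut_assoc_inv tens_compl !compA.
  rewrite (tail20 (tens_inverse (cut_glue _ _) (comp1f _))). by rewrite swap2E !compA.
Qed.

Lemma glue_swap_blocks X Y R : NoDup (Y ++ X) ->
  perm (Y ++ X ++ R) (X ++ Y ++ R) ∘ (glue Y (X ++ R) ∘ (id_ ⊠ glue X R))
  = glue X (Y ++ R) ∘ ((id_ ⊠ glue Y R) ∘ swap2 _ _ _).
Proof.
  move=> N.
  apply: (split_mono_cancel (r := (id_ ⊠ cut Y R) ∘ cut X (Y ++ R))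
    (s := glue X (Y ++ R) ∘ (id_ ⊠ glue Y R))).
  { rewrite !compA (tail20 (tens_inverse (comp1f _) (glue_cut _ _))). exact: glue_cut. }
  rewrite !compA (tail20 (cut_glue _ _)) (tail20 (tens_inverse (comp1f _) (cut_glue _ _))).
  rewrite (tail33 (perm_swap_blocks R N)) (tail20 (cut_glue _ _))
      (tens_inverse (comp1f _) (cut_glue _ _)). exact: compf1.
Qed.

Lemma Permutation_flat_map_remove1 (g : nat -> list nat) x G : In x G ->
  Permutation (flat_map g G) (g x ++ flat_map g (remove1 x G)).
Proof. move=> I. exact: (Permutation_flat_map g (remove1_Permutation I)). Qed.

Lemma split_wires_pull g x G : In x G -> NoDup (flat_map g G) ->
  perm (flat_map g G) (g x ++ flat_map g (remove1 x G)) ∘ split_wires g G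
  = glue (g x) (flat_map g (remove1 x G)) ∘ ((icop (g x) ⊠ split_wires g (remove1 x G)) ∘ pull x
      G).
Proof.
  elim: G => [//|y G IH] I.
  case: (Nat.eq_dec x y) => [E|N].
  - subst y => _. rewrite split_wires_cons /=. case: Nat.eq_dec => // _. by rewrite perm_id
      comp1f compf1.
  - have I' : In x G by case: I => // F; case: N.
    rewrite split_wires_cons => ND. move: (ND) => /= ND'.
    have {}IH := IH I' (NoDup_app_remove_l _ _ ND').
    move=> /=. case: Nat.eq_dec => // _ /=.
    have P := Permutation_flat_map_remove1 g I'.
    rewrite -(perm_comp (B := g y ++ g x ++ flat_map g (remove1 x G))).
    + exact: Permutation_app_head.
    + exact: Permutation_app_swap_app.
    + have NX : NoDup (g y ++ g x).
      { apply: (NoDup_app_remove_r _ (flat_map g (remove1 x G))). rewrite -app_assoc.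
        apply: (Permutation_NoDup _ ND'). exact: Permutation_app_head. }
      rewrite !compA (tail22 (perm_glue (Permutation_refl (g y)) P)) perm_id tens_fuse comp1f IH.
      have -> : icop (g y) ⊠ (glue (g x) (flat_map g (remove1 x G)) ∘
          ((icop (g x) ⊠ split_wires g (remove1 x G)) ∘ pull x G))
        = (id_ ⊠ glue (g x) (flat_map g (remove1 x G)))
          ∘ ((icop (g y) ⊠ (icop (g x) ⊠ split_wires g (remove1 x G))) ∘ (id_ ⊠ pull x G)).
      { by rewrite !tens_fuse comp1f compf1. }
      rewrite (tail33 (glue_swap_blocks _ NX)) (tail22 (swap2_natural _ _ _)) -?compA !compA.
      by rewrite (tail21 (tens_fuse _ _ _ _)) comp1f.
Qed.

(** Wires that cross before splitting become blocks that cross after it. The block crossing rests on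
    [perm_braid], so distinctness is required of the new names. *)
Lemma split_wires_perm g G G' : Permutation G G' -> NoDup (flat_map g G) ->
  perm (flat_map g G) (flat_map g G') ∘ split_wires g G = split_wires g G' ∘ perm G G'.
Proof.
  elim: G' G => [|x G' IH] G P ND.
  - move/Permutation_sym/Permutation_nil: P => ->. by rewrite /= !perm_id.
  - have I : In x G by rewrite P; left.
    have P' := Permutation_remove1 P.
    have PR := Permutation_flat_map_remove1 g I.
    have ND' : NoDup (flat_map g (remove1 x G)).
    { apply: (NoDup_app_remove_l (g x)). exact: (Permutation_NoDup PR). }
    change (flat_map g (x :: G')) with (g x ++ flat_map g G').
    rewrite -(perm_comp PR); last first.
    + rewrite split_wires_cons permE !compA (split_wires_pull I ND).
      rewrite (tail22 (perm_glue (Permutation_refl (g x)) (Permutation_flat_map g P'))) perm_id.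
      rewrite (tail21 (tens_fuse _ _ _ _)) comp1f (IH _ P' ND').
      by rewrite (tail21 (tens_fuse _ _ _ _)) compf1.
    + apply: Permutation_app_head. exact: Permutation_flat_map.
Qed.

(** * Soundness of symbolic execution *)

Hypothesis Hp : is_pivotal H m D e S p.

Fixpoint ty_ob (a : ty) : K :=
  match a with tI => unitob | tX => H | tT a b => ty_ob a ⊗ ty_ob b end.

Fixpoint denote (a b : ty) (d : dia a b) : Hom (ty_ob a) (ty_ob b) :=
  match d in dia a b return Hom (ty_ob a) (ty_ob b) with
  | dId a => idm (ty_ob a)
  | dComp d1 d2 => denote d1 ∘ denote d2
  | dTens d1 d2 => denote d1 ⊠ denote d2
  | dAssoc a b c => assoc (ty_ob a) (ty_ob b) (ty_ob c)
  | dAssoci a b c => associ (ty_ob a) (ty_ob b) (ty_ob c)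
  | dLunit a => lunit (ty_ob a)
  | dLuniti a => luniti (ty_ob a)
  | dRunit a => runit (ty_ob a)
  | dRuniti a => runiti (ty_ob a)
  | dBraid a b => braid (ty_ob a) (ty_ob b)
  | dM => m | dU => u | dD => D | dE => e | dS => S | dP => p
  end.

Fixpoint eval_term (t : term) : Hom (wires (term_vars t)) H :=
  match t with
  | Var x => runit H
  | Antip t => S ∘ eval_term t
  | Prod t1 t2 => m ∘ ((eval_term t1 ⊠ eval_term t2) ∘ cut (term_vars t1) (term_vars t2))
  | One => u
  | Pivot => p
  end.

Fixpoint eval_val (a : ty) : forall v : val a, Hom (wires (vars v)) (ty_ob a) :=
  match a with
  | tI => fun _ => id_
  | tX => eval_term
  | tT a b => fun v => (eval_val v.1 ⊠ eval_val v.2) ∘ cut (vars v.1) (vars v.2)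
  end.

Fixpoint split_inputs (a : ty) : forall s : splitting a, Hom (ty_ob a) (wires (names s)) :=
  match a with
  | tI => fun _ => id_
  | tX => icop
  | tT a b => fun s => glue (names s.1) (names s.2) ∘ (split_inputs s.1 ⊠ split_inputs s.2)
  end.

Lemma eval_val_pair a b (v : val (tT a b)) : eval_val v = (eval_val v.1 ⊠ eval_val v.2) ∘ cut
    (vars v.1) (vars v.2).
Proof. by []. Qed.
Lemma split_inputs_pair a b (s : splitting (tT a b)) : split_inputs s = glue (names s.1)
    (names s.2) ∘ (split_inputs s.1 ⊠ split_inputs s.2).
Proof. by []. Qed.

Lemma names_resplit_map g a (s : splitting a) : names (resplit_map g s) = flat_map g (names s).
Proof.
  elim: a s => [//|//|a IHa b IHb] [s1 s2] /=. by rewrite flat_map_app IHa IHb.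
Qed.

Lemma split_wires_glue g G1 G2 :
  perm (flat_map g (G1 ++ G2)) (flat_map g G1 ++ flat_map g G2) ∘
      (split_wires g (G1 ++ G2) ∘ glue G1 G2)
  = glue _ _ ∘ (split_wires g G1 ⊠ split_wires g G2).
Proof.
  apply: (split_epi_cancel (cut_glue G1 G2)).
  apply: (split_mono_cancel (glue_cut _ _)).
  by rewrite !compA glue_cut compf1 split_wires_app (tail20 (cut_glue _ _)).
Qed.

Lemma split_inputs_resplit_map g a (s : splitting a) :
  perm (flat_map g (names s)) (names (resplit_map g s)) ∘
      (split_wires g (names s) ∘ split_inputs s) = split_inputs (resplit_map g s).
Proof.
  elim: a s => [|/=|a IHa b IHb] s.
  - by case: s; rewrite /= perm_id !comp1f.
  - by rewrite perm_id comp1f split_wires_icop.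
  - rewrite split_inputs_pair. change (resplit_map g s) with
      (resplit_map g s.1, resplit_map g s.2). rewrite split_inputs_pair /= -IHa -IHb.
    have E1 := names_resplit_map g s.1. have E2 := names_resplit_map g s.2.
    rewrite -(perm_comp (B := flat_map g (names s.1) ++ flat_map g (names s.2))).
    + by rewrite flat_map_app.
    + by rewrite E1 E2.
    + rewrite !compA (tail32 (split_wires_glue _ _ _)) (tail22 (perm_glue _ _)) ?E1 ?E2 //.
      by rewrite !tens_fuse.
Qed.

(** The meaning of a Sweedler expression in three stages: take the components of the inputs, bring
    them into the order in which they occur, multiply out. *)
Definition sem (a b : ty) (s : splitting a) (v : val b) : Hom (ty_ob a) (ty_ob b) :=
  eval_val v ∘ (perm (names s) (vars v) ∘ split_inputs s).

(* [transports f v v'] and [splits g f v v']: applying [f] to the value [v] gives [v'],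
   after [g] has replaced each Sweedler component by several in the second case. *)
Definition transports (a b : ty) (f : Hom (ty_ob a) (ty_ob b)) (v : val a) (v' : val b) :=
  Permutation (vars v) (vars v') /\ f ∘ eval_val v = eval_val v' ∘ perm (vars v) (vars v').

Definition splits (g : nat -> list nat) (a b : ty) (f : Hom (ty_ob a) (ty_ob b)) (v : val a)
    (v' : val b) :=
  Permutation (flat_map g (vars v)) (vars v')
  /\ f ∘ eval_val v = eval_val v' ∘ (perm (flat_map g (vars v)) (vars v') ∘ split_wires g
      (vars v)).

Lemma transports_id a (v : val a) : transports (idm (ty_ob a)) v v.
Proof. split => //. by rewrite perm_id comp1f compf1. Qed.

Lemma transports_comp a b c (f : Hom (ty_ob a) (ty_ob b)) (h : Hom (ty_ob b) (ty_ob c)) v v' v'' :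
  transports f v v' -> transports h v' v'' -> transports (h ∘ f) v v''.
Proof.
  move=> [P E] [P' E']. split; first by rewrite P.
  by rewrite compA E (tail22 E') perm_comp.
Qed.

Lemma splits_transports g a b c (f : Hom (ty_ob a) (ty_ob b)) (h : Hom (ty_ob b) (ty_ob c)) v v'
    v'' :
  splits g f v v' -> transports h v' v'' -> splits g (h ∘ f) v v''.
Proof.
  move=> [P E] [P' E']. split; first by rewrite P.
  by rewrite compA E (tail22 E') (tail21 (perm_comp P P')).
Qed.

Lemma transports_tens a b a' b' (f : Hom (ty_ob a) (ty_ob b)) (h : Hom (ty_ob a') (ty_ob b')) v
    v' w w' :
  transports f v v' -> transports h w w' -> transports (a := tT a a') (b := tT b b') (f ⊠ h)
      (v, w) (v', w').
Proof.
  move=> [P E] [P' E']. split; first by apply: Permutation_app.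
  rewrite !eval_val_pair /= !compA perm_app // (tail21 (tens_fuse _ _ _ _)) E E'. by rewrite
      (tail21 (tens_fuse _ _ _ _)).
Qed.

Lemma splits_tens g a b a' b' (f : Hom (ty_ob a) (ty_ob b)) (h : Hom (ty_ob a') (ty_ob b')) v v'
    w w' :
  splits g f v v' -> splits g h w w' -> splits (a := tT a a') (b := tT b b') g (f ⊠ h) (v, w)
      (v', w').
Proof.
  move=> [P E] [P' E'].
  have PF : Permutation (flat_map g (vars v ++ vars w))
      (flat_map g (vars v) ++ flat_map g (vars w)).
  { by rewrite flat_map_app. }
  split; first by rewrite PF; apply: Permutation_app.
  rewrite !eval_val_pair /= -(perm_comp PF); first by apply: Permutation_app.
  rewrite !compA -(compA (cut _ _)) perm_app // compA split_wires_app
      (tail21 (tens_fuse _ _ _ _)) E E'.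
  by rewrite -!tens_fuse !compA.
Qed.

Lemma transports_inv a b (f : Hom (ty_ob a) (ty_ob b)) (f' : Hom (ty_ob b) (ty_ob a)) v v' :
  f ∘ f' = id_ -> transports f' v' v -> transports f v v'.
Proof.
  move=> F [P E]. have P' := Permutation_sym P. split => //.
  apply: (split_epi_cancel (perm_inv P')). rewrite !compA -E (tail20 F) perm_inv //. by rewrite
      compf1.
Qed.

Lemma transports_assoc a b c (v : val a) (w : val b) (x : val c) :
  transports (a := tT (tT a b) c) (b := tT a (tT b c)) (assoc _ _ _) ((v, w), x) (v, (w, x)).
Proof.
  split; first by rewrite /= app_assoc.
  rewrite !eval_val_pair /=.
  have -> : ((eval_val v ⊠ eval_val w) ∘ cut (vars v) (vars w)) ⊠ eval_val x
    = ((eval_val v ⊠ eval_val w) ⊠ eval_val x) ∘ (cut (vars v) (vars w) ⊠ id_) by rewrite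
        tens_fuse compf1.
  rewrite !compA (tail22 (assoc_natural _ _ _)) cut_assoc. rewrite (tail21 (tens_fuse _ _ _ _))
      compf1. done.
Qed.

Lemma transports_associ a b c (v : val a) (w : val b) (x : val c) :
  transports (b := tT (tT a b) c) (a := tT a (tT b c)) (associ _ _ _) (v, (w, x)) ((v, w), x).
Proof. apply: (transports_inv _ (transports_assoc _ _ _)). exact: associK. Qed.

Lemma transports_braid a b (v : val a) (w : val b) : NoDup (vars v ++ vars w) ->
  transports (a := tT a b) (b := tT b a) (braid _ _) (v, w) (w, v).
Proof.
  move=> N. split; first exact: Permutation_app_comm.
  by rewrite !eval_val_pair /= (tail22 (braid_natural _ _)) perm_braid // compA.
Qed.

Lemma transports_lunit a (v : val a) : transports (a := tT tI a) (b := a) (lunit _) (tt, v) v.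
Proof.
  split => //. by rewrite eval_val_pair /= (tail22 (lunit_natural _)) lunitK perm_id.
Qed.

Lemma transports_luniti a (v : val a) : transports (a := a) (b := tT tI a) (luniti _) v (tt, v).
Proof. apply: (transports_inv _ (transports_lunit _)). exact: lunitiK. Qed.

Lemma transports_runit a (v : val a) : transports (a := tT a tI) (b := a) (runit _) (v, tt) v.
Proof.
  split; first by rewrite /= app_nil_r.
  by rewrite eval_val_pair /= (tail22 (runit_natural _)) cut_nilr.
Qed.

Lemma transports_runiti a (v : val a) : transports (a := a) (b := tT a tI) (runiti _) v (v, tt).
Proof. apply: (transports_inv _ (transports_runit _)). exact: runitiK. Qed.

Lemma transports_refl a b (f : Hom (ty_ob a) (ty_ob b)) (v : val a) (v' : val b)
    (E : vars v = vars v') : f ∘ eval_val v = eval_val v' ∘ perm (vars v) (vars v') -> transports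
        f v v'.
Proof. split => //. by rewrite E. Qed.

Lemma transports_m (t1 t2 : term) : transports (a := tT tX tX) (b := tX) m (t1, t2) (Prod t1 t2).
Proof. by apply: transports_refl => //; rewrite perm_id compf1. Qed.
Lemma transports_u : transports (a := tI) (b := tX) u tt One.
Proof. by apply: transports_refl => //; rewrite perm_id. Qed.
Lemma transports_p : transports (a := tI) (b := tX) p tt Pivot.
Proof. by apply: transports_refl => //; rewrite perm_id. Qed.
Lemma transports_S (t : term) : transports (a := tX) (b := tX) S t (Antip t).
Proof. by apply: transports_refl => //; rewrite perm_id compf1. Qed.

Lemma icop1 x : icop [x] = runiti H.
Proof. by rewrite /= (h_counitr _ _ _ _ _ _ HH). Qed.

Lemma glue1 x F : glue [x] F ∘ (icop [x] ⊠ id_) = id_.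
Proof.
  rewrite icop1 /= !compA. rewrite (tail21 (triangleE _ _)) (tens_inverse (runitK _) (comp1f _)).
      done.
Qed.

Lemma flat_map_triv (g : nat -> list nat) G : (forall x, In x G -> g x = [x]) -> flat_map g G = G.
Proof.
  elim: G => [//|y G IH] Hg /=. rewrite Hg /=; first by left.
  by rewrite IH // => z I; apply: Hg; right.
Qed.

Lemma split_wires_triv g G : (forall x, In x G -> g x = [x]) -> split_wires g G = perm G
    (flat_map g G).
Proof.
  elim: G => [|x G IH] Hg; first by rewrite perm_id.
  rewrite split_wires_cons IH; first by move=> y I; apply: Hg; right.
  have Ex : g x = [x] by apply: Hg; left.
  have X : forall L F (f : Hom (wires G) (wires F)), L = [x] ->
    glue L F ∘ (icop L ⊠ f) = perm (x :: F) (L ++ F) ∘ (id_ ⊠ f).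
  { move=> L F f ->. by rewrite perm_id comp1f tens_lr -compA glue1 comp1f. }
  have EF : flat_map g G = G by apply: flat_map_triv => y I; apply: Hg; right.
  rewrite (X _ _ _ Ex) -(perm_cons_same x).
  apply: perm_comp; first by rewrite EF. by rewrite /= Ex.
Qed.

Lemma splits_triv g a b (f : Hom (ty_ob a) (ty_ob b)) v v' :
  (forall x, In x (vars v) -> g x = [x]) -> transports f v v' -> splits g f v v'.
Proof.
  move=> Hg [P E]. have EF := flat_map_triv Hg. split; first by rewrite EF.
  by rewrite split_wires_triv // perm_comp // EF.
Qed.

(** The splitting [g] of the components in [v] moves through the permutation by [split_wires_perm],
    and coassociativity absorbs it into the coproducts of the inputs. *)
Lemma sem_splits g a b c (f : Hom (ty_ob a) (ty_ob b)) v v' (s : splitting c) :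
  splits g f v v' -> Permutation (names s) (vars v) -> NoDup (flat_map g (names s)) ->
  Permutation (names (resplit_map g s)) (vars v') /\ f ∘ sem s v = sem (resplit_map g s) v'.
Proof.
  move=> [P E] PS N.
  have PF := Permutation_flat_map g PS.
  have PM : Permutation (flat_map g (names s)) (names (resplit_map g s)) by rewrite
      names_resplit_map.
  have PM' : Permutation (names (resplit_map g s)) (vars v') by rewrite -PM PF.
  split => //.
  rewrite /sem -split_inputs_resplit_map -(compA f) E !compA -(compA (split_wires _ _))
      -split_wires_perm // !compA.
  rewrite -(compA (perm _ (vars v'))) perm_comp //.
  by rewrite -(compA (perm _ (vars v')) (perm _ (names _))) perm_comp.
Qed.

Lemma sem_transports a b c (f : Hom (ty_ob a) (ty_ob b)) v v' (s : splitting c) :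
  transports f v v' -> Permutation (names s) (vars v) ->
  Permutation (names s) (vars v') /\ f ∘ sem s v = sem s v'.
Proof.
  move=> [P E] PS. split; first by rewrite PS.
  by rewrite /sem (tail22 E) (tail21 (perm_comp PS P)).
Qed.

Lemma glue_nilr L : glue L [] = perm L (L ++ []) ∘ runit _.
Proof.
  have P : Permutation (L ++ []) L by rewrite app_nil_r.
  apply: (split_epi_cancel (cut_glue L [])).
  by rewrite glue_cut compA cut_nilr perm_inv.
Qed.

Lemma split_wires1 g x : split_wires g [x] = perm (g x) (g x ++ []) ∘ (icop (g x) ∘ runit _).
Proof. by rewrite split_wires_cons /= glue_nilr !compA runit_natural. Qed.

Lemma perm_split_wires1 g x G : g x = G ->
  perm (flat_map g [x]) G ∘ split_wires g [x] = icop G ∘ runit _.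
Proof.
  move=> E. have P : Permutation (g x) (g x ++ []) by rewrite app_nil_r.
  have P' : Permutation (g x ++ []) G by rewrite app_nil_r E.
  rewrite split_wires1 /= (tail21 (perm_comp P P')). subst G. by rewrite perm_id comp1f.
Qed.

Lemma runit_icop1 x : runit H ∘ icop [x] = id_.
Proof. by rewrite icop1 runitK. Qed.

Lemma cut_icop l1 l2 : cut l1 l2 ∘ icop (l1 ++ l2) = (icop l1 ⊠ icop l2) ∘ D.
Proof. by rewrite icop_app (tail20 (cut_glue _ _)). Qed.

Lemma splits_D_var g x x' : g x = [x; x'] -> splits (a := tX) (b := tT tX tX) g D (Var x)
    (Var x, Var x').
Proof.
  move=> E. split; first by rewrite /= E.
  change (vars (a := tX) (Var x)) with [x]. rewrite eval_val_pair (perm_split_wires1 E).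
  rewrite compA (tail21 (cut_icop [x] [x'])) -!compA tens_fuse.
  change (eval_val _) with (runit H). by rewrite !runit_icop1 tens11 comp1f.
Qed.

Lemma transports_ms a b c d (v : val a) (w : val b) (x : val c) (y : val d) :
  NoDup (vars w ++ vars x) ->
  transports (a := tT (tT a b) (tT c d)) (b := tT (tT a c) (tT b d))
    (ms (ty_ob a) (ty_ob b) (ty_ob c) (ty_ob d)) ((v, w), (x, y)) ((v, x), (w, y)).
Proof.
  move=> N. rewrite /ms !compA.
  refine (transports_comp (b := tT a (tT c (tT b d))) (v' := (v, (x, (w, y)))) _ _);
    last exact: (transports_associ v x ((w, y) : val (tT b d))).
  refine (transports_comp (b := tT a (tT b (tT c d))) (v' := (v, (w, (x, y)))) _ _).
  { exact: (transports_assoc v w ((x, y) : val (tT c d))). }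
  refine (transports_tens (a := a) (b := a) (a' := tT b (tT c d)) (b' := tT c (tT b d)) _ _).
  { exact: transports_id. }
  refine (transports_comp (b := tT (tT c b) d) (v' := ((x, w), y)) _ _); last exact:
      transports_assoc.
  refine (transports_comp (b := tT (tT b c) d) (v' := ((w, x), y)) _ _); first exact:
      transports_associ.
  refine (transports_tens (a := tT b c) (b := tT c b) (a' := d) (b' := d) _ _);
    [exact: transports_braid|exact: transports_id].
Qed.

Definition S_anticomul := D ∘ S = (S ⊠ S) ∘ (braid H H ∘ D).

Lemma splits_D_Prod g (t1 t2 : term) v1 v2 w1 w2 :
  NoDup (flat_map g (term_vars t1 ++ term_vars t2)) ->
  splits (a := tX) (b := tT tX tX) g D t1 (v1, w1) ->
  splits (a := tX) (b := tT tX tX) g D t2 (v2, w2) ->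
  splits (a := tX) (b := tT tX tX) g D (Prod t1 t2) (Prod v1 v2, Prod w1 w2).
Proof.
  move=> N H1 H2.
  (* The exchange in [ms] braids the second half of [t1] with the first half of [t2], whose names
     must be distinct. *)
  have N' : NoDup (term_vars w1 ++ term_vars v2).
  { move: (splits_tens H1 H2) => [P _]. move: (Permutation_NoDup P N) => /= {}N.
    rewrite -app_assoc in N. move/NoDup_app_remove_l: N. rewrite app_assoc. exact:
        NoDup_app_remove_r. }
  have : splits (a := tT tX tX) (b := tT tX tX) g (D ∘ m) (t1, t2) (Prod v1 v2, Prod w1 w2).
  { rewrite (h_Dm _ _ _ _ _ _ HH) compA.
    refine (splits_transports (b := tT (tT tX tX) (tT tX tX)) (v' := ((v1, v2), (w1, w2))) _
      (transports_tens (a := tT tX tX) (b := tX) (a' := tT tX tX) (b' := tX) (transports_m _ _)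
          (transports_m _ _))).
    refine (splits_transports (b := tT (tT tX tX) (tT tX tX)) (v' := ((v1, w1), (v2, w2)))
      (splits_tens (a := tX) (b := tT tX tX) (a' := tX) (b' := tT tX tX) H1 H2) _).
    exact: (transports_ms (a := tX) (b := tX) (c := tX) (d := tX)). }
  case=> [P E]. split; first exact: P. by rewrite -E compA.
Qed.

Lemma splits_dup g N (t : term) :
  (S_anticomul \/ sfree t = true) -> (forall x, In x (term_vars t) -> g x = [x; x + N]) ->
  NoDup (flat_map g (term_vars t)) ->
  splits (a := tX) (b := tT tX tX) g D t (dup_term N t).
Proof.
  elim: t => [x|t IH|t1 IH1 t2 IH2||] F Hg ND.
  - apply: splits_D_var. by apply: Hg; left.
  - case: F => // A. have {}IH := IH (or_introl A) Hg ND.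
    move: IH => /=. case: (dup_term N t) => [t1 t2] /= IH.
    have N' : NoDup (term_vars t1 ++ term_vars t2) by move: IH => [P _]; apply:
        (Permutation_NoDup P).
    have [P E] : splits (a := tX) (b := tT tX tX) g (D ∘ S) t (Antip t2, Antip t1).
    { rewrite A.
      refine (splits_transports (b := tT tX tX) (v' := (t2, t1)) _
        (transports_tens (a := tX) (b := tX) (a' := tX) (b' := tX) (transports_S _)
            (transports_S _))).
      refine (splits_transports (b := tT tX tX) IH _). exact:
          (transports_braid (a := tX) (b := tX)). }
    split; first exact: P. by rewrite -E compA.
  - have ND' : NoDup (flat_map g (term_vars t1) ++ flat_map g (term_vars t2)) by rewrite
      -flat_map_app.
    change (dup_term N (Prod t1 t2))
      with (Prod (dup_term N t1).1 (dup_term N t2).1, Prod (dup_term N t1).2 (dup_term N t2).2).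
    have {}IH1 : splits (a := tX) (b := tT tX tX) g D t1 (dup_term N t1).
    { apply: IH1; last exact: (NoDup_app_remove_r _ _ ND').
      - by case: F => [|/=/andb_prop [? ?]]; [left|right].
      - by move=> x I; apply: Hg; apply/in_or_app; left. }
    have {}IH2 : splits (a := tX) (b := tT tX tX) g D t2 (dup_term N t2).
    { apply: IH2; last exact: (NoDup_app_remove_l _ _ ND').
      - by case: F => [|/=/andb_prop [? ?]]; [left|right].
      - by move=> x I; apply: Hg; apply/in_or_app; right. }
    apply: splits_D_Prod => //; by rewrite -surjective_pairing.
  - split => //=. by rewrite perm_id !compf1 (h_Du _ _ _ _ _ _ HH).
  - split => //=. by rewrite perm_id !compf1 (piv_D _ _ _ _ _ _ Hp).
Qed.

Lemma mul_unitl : m ∘ (u ⊠ id_) = lunit H.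
Proof. exact: (h_unitl _ _ _ _ _ _ HH). Qed.

Lemma mul_unitr : m ∘ (id_ ⊠ u) = runit H.
Proof. exact: (h_unitr _ _ _ _ _ _ HH). Qed.

(** The antipode axiom at the grouplike element 1 reads S(1) 1 = 1. *)
Lemma S_unit : S ∘ u = u.
Proof.
  have E : m ∘ ((S ⊠ id_) ∘ (D ∘ u)) = u.
  { by rewrite -!compA (h_antil _ _ _ _ _ _ HH) compA (h_eu _ _ _ _ _ _ HH) compf1. }
  rewrite -{2}E (h_Du _ _ _ _ _ _ HH) (tail21 (tens_fuse _ _ _ _)) comp1f tens_rl compA.
  by rewrite (tail21 mul_unitr) (tail22 (runit_natural _)) -lunit_runit lunitK compf1.
Qed.

Lemma counit_S : e ∘ S = e.
Proof.
  have E : e ∘ (m ∘ ((S ⊠ id_) ∘ D)) = e.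
  { have -> : m ∘ ((S ⊠ id_) ∘ D) = u ∘ e by rewrite -(h_antil _ _ _ _ _ _ HH) compA.
    by rewrite -compA (h_eu _ _ _ _ _ _ HH) comp1f. }
  rewrite -{2}E -compA (h_em _ _ _ _ _ _ HH) compA (tail21 (tens_fuse _ _ _ _)) compf1 tens_lr
      compA.
  by rewrite (h_counitr _ _ _ _ _ _ HH) lunit_runit (tail22 (runit_natural _)) runitK compf1.
Qed.

Lemma splits_kill g (t : term) :
  (forall x, In x (term_vars t) -> g x = []) -> splits (a := tX) (b := tI) g e t tt.
Proof.
  elim: t => [x|t IH|t1 IH1 t2 IH2||] Hg.
  - have E : g x = [] by apply: Hg; left.
    split; first by rewrite /= E.
    change (vars (a := tX) (Var x)) with [x]. by rewrite (perm_split_wires1 E) comp1f.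
  - have [P E] := IH Hg. split; first exact: P. by rewrite -E /= -compA counit_S.
  - have H1 : splits (a := tX) (b := tI) g e t1 tt.
    { by apply: IH1 => x I; apply: Hg; apply/in_or_app; left. }
    have H2 : splits (a := tX) (b := tI) g e t2 tt.
    { by apply: IH2 => x I; apply: Hg; apply/in_or_app; right. }
    have [P E] : splits (a := tT tX tX) (b := tI) g (e ∘ m) (t1, t2) tt.
    { rewrite (h_em _ _ _ _ _ _ HH).
      exact: (splits_transports (splits_tens (a := tX) (b := tI) (a' := tX) (b' := tI) H1 H2)
          (transports_lunit (a := tI) tt)). }
    split; first exact: P. by rewrite -E compA.
  - split => //=. by rewrite perm_id !compf1 (h_eu _ _ _ _ _ _ HH).
  - split => //=. by rewrite perm_id !compf1 (piv_e _ _ _ _ _ _ Hp).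
Qed.

Lemma membP x l : memb x l = true <-> In x l.
Proof.
  rewrite /memb existsb_exists. split.
  - by case=> y [I /Nat.eqb_eq ->].
  - move=> I. exists x. by rewrite Nat.eqb_refl.
Qed.

Lemma nodupbP l : nodupb l = true -> NoDup l.
Proof.
  elim: l => [|x l IH] /=; first by constructor.
  move/andb_prop => [/negb_true_iff F /IH N]. constructor => // I.
  by move/membP: I; rewrite F.
Qed.

Lemma subst_on_in l f x : In x l -> subst_on l f x = f x.
Proof. by move/membP; rewrite /subst_on => ->. Qed.

Lemma subst_on_out l f x : ~ In x l -> subst_on l f x = [x].
Proof.
  rewrite /subst_on => F. case E: memb => //. by case: F; apply/membP.
Qed.

(* The bystander [r] is what allows [f] to act on a part of the value. *)
Definition step (a b : ty) (f : Hom (ty_ob a) (ty_ob b)) c (s : splitting c) (v : val a)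
    (s' : splitting c) (v' : val b) :=
  forall q (r : val q), NoDup (names s) -> Permutation (names s) (vars v ++ vars r) ->
  NoDup (names s') /\ Permutation (names s') (vars v' ++ vars r) /\
  (f ⊠ idm (ty_ob q)) ∘ sem s ((v, r) : val (tT a q)) = sem s' ((v', r) : val (tT b q)).

Lemma step_transports a b (f : Hom (ty_ob a) (ty_ob b)) c (s : splitting c) v v' :
  (NoDup (vars v) -> transports f v v') -> step f s v s v'.
Proof.
  move=> F q r N P. split => //.
  have Nv : NoDup (vars v).
  { apply: (NoDup_app_remove_r _ (vars r)). exact: (Permutation_NoDup P). }
  exact: (sem_transports (a := tT a q) (b := tT b q) (transports_tens (F Nv) (transports_id r))).
Qed.

Lemma step_splits a b (f : Hom (ty_ob a) (ty_ob b)) c (s s' : splitting c) (v : val a) v' h :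
  resplit h (vars v) s = Some s' ->
  (NoDup (flat_map (subst_on (vars v) h) (vars v)) -> splits (subst_on (vars v) h) f v v') ->
  step f s v s' v'.
Proof.
  rewrite /resplit. case E: (nodupb _) => //. case=> <- F q r N P.
  move/nodupbP: E => E.
  have N' : NoDup (names (resplit_map (subst_on (vars v) h) s)) by rewrite names_resplit_map.
  split => //.
  have PF := Permutation_flat_map (subst_on (vars v) h) P.
  have Nv := Permutation_NoDup PF E. rewrite flat_map_app in Nv.
  have {}F := F (NoDup_app_remove_r _ _ Nv).
  (* The bystander shares no name with [v], so the substitution leaves it alone. *)
  have R : splits (subst_on (vars v) h) (idm (ty_ob q)) r r.
  { apply: splits_triv (transports_id r) => x I. apply: subst_on_out => J.
    have ND := Permutation_NoDup P N. move: J I ND. clear.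
    elim: (vars v) => [//|y l IH] /= [->|I] J /NoDup_cons_iff [A B].
    - apply: A. apply/in_or_app. by right.
    - exact: IH. }
  exact: (sem_splits (a := tT a q) (b := tT b q) (splits_tens F R) P E).
Qed.

Lemma step_comp a b b' (f : Hom (ty_ob a) (ty_ob b)) (h : Hom (ty_ob b) (ty_ob b')) c
    (s s' s'' : splitting c) v v' v'' :
  step f s v s' v' -> step h s' v' s'' v'' -> step (h ∘ f) s v s'' v''.
Proof.
  move=> F G q r N P. have [N' [P' E']] := F q r N P. have [N'' [P'' E'']] := G q r N' P'.
  split => //; split => //. by rewrite tens_compl compA E' E''.
Qed.

(* [h] acts on a value with [v'] on its left, which is braided out of the way and back. *)
Lemma step_tens a b a' b' (f : Hom (ty_ob a) (ty_ob b)) (h : Hom (ty_ob a') (ty_ob b')) c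
    (s s' s'' : splitting c)
    v v' w w' :
  step f s v s' v' -> step h s' w s'' w' ->
  step (a := tT a a') (b := tT b b') (f ⊠ h) s (v, w) s'' (v', w').
Proof.
  move=> F G q r N P.
  have [P1 E1] := sem_transports (transports_assoc v w r) P.
  have [N2 [P2 E2]] := F _ ((w, r) : val (tT a' q)) N P1.
  have Nb : NoDup (vars v' ++ vars ((w, r) : val (tT a' q))) by apply: (Permutation_NoDup P2).
  have [P3 E3] := sem_transports (transports_braid (a := b) (b := tT a' q) Nb) P2.
  have [P4 E4] := sem_transports (transports_assoc w r v') P3.
  have [N5 [P5 E5]] := G _ ((r, v') : val (tT q b)) N2 P4.
  have [P6 E6] := sem_transports (transports_associ w' r v') P5.
  have Nb' : NoDup (vars ((w', r) : val (tT b' q)) ++ vars v') by apply: (Permutation_NoDup P6).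
  have [P7 E7] := sem_transports (transports_braid (a := tT b' q) (b := b) Nb') P6.
  have [P8 E8] := sem_transports (transports_associ v' w' r) P7.
  split => //; split => //. rewrite -E8 -E7 -E6 -E5 -E4 -E3 -E2 -E1 /=.
  rewrite (tail22 (braid_natural _ _)) -(tens11 (ty_ob a') (ty_ob q))
      (tail22 (assoc_natural _ _ _)) (tail21 (tens_fuse _ _ _ _)).
  rewrite comp1f compf1 (tail22 (associ_natural _ _ _)) (tail22 (braid_natural _ _))
      (tail22 (associ_natural _ _ _)).
  by rewrite (tail20 (associK _ _ _)) (tail20 (braidK _ _)) (tail20 (associK _ _ _)).
Qed.

(** * Equality of terms and reduction to words *)

Definition S_antimul := S ∘ m = m ∘ ((S ⊠ S) ∘ braid H H).

Definition teq (t t' : term) := transports (a := tX) (b := tX) (idm H) t t'.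

Lemma teq_refl t : teq t t.
Proof. exact: transports_id. Qed.
Lemma teq_trans t1 t2 t3 : teq t1 t2 -> teq t2 t3 -> teq t1 t3.
Proof.
  move=> A B. have := transports_comp (a := tX) (b := tX) (c := tX) A B. by rewrite comp1f.
Qed.
Lemma teq_sym t t' : teq t t' -> teq t' t.
Proof. apply: (transports_inv (a := tX) (b := tX)). exact: comp1f. Qed.

(** This lets a law between morphisms act on a compound term: [v] lists the parts of [t] and [f]
    assembles them. *)
Lemma teq_of a (f : Hom (ty_ob a) H) (v : val a) (t t' : term) :
  vars v = term_vars t -> eval_term t = f ∘ (eval_val v ∘ perm (term_vars t) (vars v)) ->
  transports (a := a) (b := tX) f v t' -> teq t t'.
Proof.
  move=> E F [P G]. split; first by rewrite -[vars _]E.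
  rewrite comp1f [eval_val _]F -(compA f) G !compA. f_equal. by apply: perm_comp => //; rewrite E.
Qed.

Lemma teq_Prod t1 t2 t1' t2' : teq t1 t1' -> teq t2 t2' -> teq (Prod t1 t2) (Prod t1' t2').
Proof.
  move=> A B.
  apply: (teq_of (a := tT tX tX) (f := m) (v := (t1, t2))) => //.
  { by rewrite perm_id compf1. }
  rewrite -(compf1 m) -tens11.
  refine (transports_comp (b := tT tX tX) (v' := (t1', t2')) _ (transports_m _ _)).
  exact: (transports_tens (a := tX) (b := tX) (a' := tX) (b' := tX) A B).
Qed.

Lemma teq_Antip t t' : teq t t' -> teq (Antip t) (Antip t').
Proof.
  move=> A. apply: (teq_of (a := tX) (f := S) (v := t)) => //.
  { by rewrite perm_id compf1. }
  rewrite -(compf1 S). exact: (transports_comp (b := tX) A (transports_S _)).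
Qed.

Lemma teq_assoc t1 t2 t3 : teq (Prod (Prod t1 t2) t3) (Prod t1 (Prod t2 t3)).
Proof.
  apply: (teq_of (a := tT (tT tX tX) tX) (f := m ∘ (m ⊠ id_)) (v := ((t1, t2), t3))) => //.
  { rewrite perm_id compf1 !compA -(compA (m ⊠ id_)) tens_fuse comp1f. done. }
  rewrite (h_assoc _ _ _ _ _ _ HH) compA.
  refine (transports_comp (b := tT tX tX) (v' := (t1, Prod t2 t3)) _ (transports_m _ _)).
  refine (transports_comp (b := tT tX (tT tX tX)) (v' := (t1, (t2, t3))) _ _).
  { exact: (transports_assoc (a := tX) (b := tX) (c := tX)). }
  exact: (transports_tens (a := tX) (b := tX) (a' := tT tX tX) (b' := tX) (transports_id _)
      (transports_m _ _)).
Qed.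

Lemma teq_Onel t : teq (Prod One t) t.
Proof.
  apply: (teq_of (a := tT tI tX) (f := m ∘ (u ⊠ id_)) (v := (tt, t))) => //.
  { rewrite perm_id compf1 compA eval_val_pair /=. by rewrite (tail21 (tens_fuse _ _ _ _)) comp1f
      compf1. }
  rewrite mul_unitl. exact: (transports_lunit (a := tX)).
Qed.

Lemma teq_Oner t : teq (Prod t One) t.
Proof.
  apply: (teq_of (a := tT tX tI) (f := m ∘ (id_ ⊠ u)) (v := (t, tt))) => //.
  { rewrite perm_id compf1 compA eval_val_pair /=. by rewrite (tail21 (tens_fuse _ _ _ _)) comp1f
      compf1. }
  rewrite mul_unitr. exact: (transports_runit (a := tX)).
Qed.

Lemma teq_Antip_One : teq (Antip One) One.
Proof. split => //=. by rewrite perm_id comp1f compf1 S_unit. Qed.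

Lemma teq_anti t1 t2 : S_antimul -> NoDup (term_vars t1 ++ term_vars t2) ->
  teq (Antip (Prod t1 t2)) (Prod (Antip t2) (Antip t1)).
Proof.
  move=> A N.
  apply: (teq_of (a := tT tX tX) (f := S ∘ m) (v := (t1, t2))) => //.
  { by rewrite perm_id compf1 compA. }
  rewrite A.
  refine (transports_comp (b := tT tX tX) (v' := (Antip t2, Antip t1)) _ (transports_m _ _)).
  refine (transports_comp (b := tT tX tX) (v' := (t2, t1)) _ _).
  { exact: (transports_braid (a := tX) (b := tX)). }
  exact: (transports_tens (a := tX) (b := tX) (a' := tX) (b' := tX) (transports_S _)
      (transports_S _)).
Qed.

Lemma perm_nil : perm [] [] = idm unitob.
Proof. by []. Qed.

Lemma teq_Pivot_Antip : teq (Prod Pivot (Antip Pivot)) One.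
Proof.
  split => //=. rewrite perm_nil comp1f compf1.
  have : m ∘ ((id_ ⊠ S) ∘ (D ∘ p)) = u.
  { rewrite -!compA (h_antir _ _ _ _ _ _ HH) compA (piv_e _ _ _ _ _ _ Hp). exact: compf1. }
  by rewrite (piv_D _ _ _ _ _ _ Hp) (tail21 (tens_fuse _ _ _ _)) comp1f.
Qed.

Lemma teq_Antip_Pivot : teq (Prod (Antip Pivot) Pivot) One.
Proof.
  split => //=. rewrite perm_nil comp1f compf1.
  have : m ∘ ((S ⊠ id_) ∘ (D ∘ p)) = u.
  { rewrite -!compA (h_antil _ _ _ _ _ _ HH) compA (piv_e _ _ _ _ _ _ Hp). exact: compf1. }
  by rewrite (piv_D _ _ _ _ _ _ Hp) (tail21 (tens_fuse _ _ _ _)) comp1f.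
Qed.

(** The composite in [piv_S2] is traversed arrow by arrow, starting from [t]; by the axiom it is the
    identity. *)
Lemma teq_pivotal t : teq (Prod Pivot (Prod (Antip (Antip t)) (Antip Pivot))) t.
Proof.
  apply: teq_sym.
  apply: (teq_of (a := tX) (f := m ∘ (id_ ⊠ m) ∘ (id_ ⊠ ((S ∘ S) ⊠ S)) ∘ (p ⊠ (id_ ⊠ p))
           ∘ luniti (H ⊗ unitob) ∘ runiti H) (v := t)) => //.
  { by rewrite (piv_S2 _ _ _ _ _ _ Hp) perm_id comp1f compf1. }
  refine (transports_comp (b := tT tX tI) (v' := (t, tt)) (transports_runiti (a := tX) _) _).
  refine (transports_comp (b := tT tI (tT tX tI)) (v' := (tt, (t, tt)))
      (transports_luniti (a := tT tX tI) _) _).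
  refine (transports_comp (b := tT tX (tT tX tX)) (v' := (Pivot, (t, Pivot)))
    (transports_tens (a := tI) (b := tX) (a' := tT tX tI) (b' := tT tX tX) transports_p
      (transports_tens (a := tX) (b := tX) (a' := tI) (b' := tX) (transports_id _) transports_p))
          _).
  refine (transports_comp (b := tT tX (tT tX tX)) (v' := (Pivot, (Antip (Antip t), Antip Pivot)))
    (transports_tens (a := tX) (b := tX) (a' := tT tX tX) (b' := tT tX tX) (transports_id _)
      (transports_tens (a := tX) (b := tX) (a' := tX) (b' := tX)
        (transports_comp (b := tX) (transports_S _) (transports_S _)) (transports_S _))) _).
  refine (transports_comp (b := tT tX tX) (v' := (Pivot, Prod (Antip (Antip t)) (Antip Pivot))) _
      (transports_m _ _)).
  exact: (transports_tens (a := tX) (b := tX) (a' := tT tX tX) (b' := tX) (transports_id _)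
      (transports_m _ _)).
Qed.

Lemma teq_Antip_Antip t : teq (Antip (Antip t)) (Prod (Antip Pivot) (Prod t Pivot)).
Proof.
  apply: teq_sym.
  apply: (teq_trans (t2 := Prod (Antip Pivot) (Prod (Prod Pivot
      (Prod (Antip (Antip t)) (Antip Pivot))) Pivot))).
  { apply: teq_Prod (teq_refl _) (teq_Prod (teq_sym (teq_pivotal _)) (teq_refl _)). }
  apply: (teq_trans (t2 := Prod (Antip Pivot) (Prod Pivot (Antip (Antip t))))).
  { apply: teq_Prod (teq_refl _) _.
    apply: teq_trans (teq_assoc _ _ _) _. apply: teq_Prod (teq_refl _) _.
    apply: teq_trans (teq_assoc _ _ _) _.
    apply: teq_trans (teq_Prod (teq_refl _) teq_Antip_Pivot) (teq_Oner _). }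
  apply: teq_trans (teq_sym (teq_assoc _ _ _)) _.
  apply: teq_trans (teq_Prod teq_Antip_Pivot (teq_refl _)) (teq_Onel _).
Qed.

Lemma teq_app w1 w2 : teq (Prod (term_of_word w1) (term_of_word w2)) (term_of_word (w1 ++ w2)).
Proof.
  elim: w1 => [|l w IH]; first exact: teq_Onel.
  exact: teq_trans (teq_assoc _ _ _) (teq_Prod (teq_refl _) IH).
Qed.

Lemma teq_one l : teq (term_of_word [l]) (term_of_letter l).
Proof. exact: teq_Oner. Qed.

Lemma teq_antip_letter l : teq (Antip (term_of_letter l)) (term_of_word (antip_letter l)).
Proof.
  case: l => [[] x|[]] /=; try exact: (teq_sym (teq_Oner _)).
  - apply: teq_trans (teq_Antip_Antip _) _.
    exact: teq_Prod (teq_refl _) (teq_Prod (teq_refl _) (teq_sym (teq_Oner _))).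
  - apply: teq_trans (teq_Antip_Antip _) _. apply: teq_trans (teq_sym (teq_assoc _ _ _)) _.
    apply: teq_trans (teq_Prod teq_Antip_Pivot (teq_refl _)) _.
    exact: teq_trans (teq_Onel _) (teq_sym (teq_Oner _)).
Qed.

Lemma teq_antip_word w : S_antimul -> NoDup (term_vars (term_of_word w)) -> teq
    (Antip (term_of_word w)) (term_of_word (antip_word w)).
Proof.
  move=> A. elim: w => [|l w IH] N /=; first exact: teq_Antip_One.
  apply: teq_trans (teq_anti A N) _.
  apply: teq_trans (teq_Prod (IH (NoDup_app_remove_l _ _ N)) (teq_antip_letter l)) _.
  exact: teq_app.
Qed.

Lemma teq_word_of fl t w : (fl = true -> S_antimul) -> NoDup (term_vars t) ->
  word_of_term fl t = Some w -> teq t (term_of_word w).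
Proof.
  move=> Hfl. elim: t w => [x|t IH|t1 IH1 t2 IH2||] w N.
  - case=> <-. exact: (teq_sym (teq_one (LV false x))).
  - move=> /=. case E: (word_of_term _ t) => [w1|//] F.
    have A := IH _ N E. apply: teq_trans (teq_Antip A) _.
    have {}N : NoDup (term_vars (term_of_word w1)) by case: A => P _; exact:
        (Permutation_NoDup P).
    (* Every word other than a single plain variable falls under this general rule. *)
    have K0 : (if fl then Some (antip_word w1) else None) = Some w -> teq
        (Antip (term_of_word w1)) (term_of_word w).
    { case: fl Hfl {IH E F} => // Hfl [<-]. apply: teq_antip_word N. exact: Hfl. }
    case: w1 {E A N} F K0 => [|[[] x|b] [|l w1]] F K0; try exact: (K0 F).
    case: F => <-.
    exact: teq_trans (teq_Antip (teq_one (LV false x))) (teq_sym (teq_one (LV true x))).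
  - move=> /=. case E1: (word_of_term _ t1) => [w1|//]. case E2: (word_of_term _ t2) => [w2|//]
      [<-].
    apply: teq_trans (teq_Prod (IH1 _ _ E1) (IH2 _ _ E2)) (teq_app _ _).
    + exact: (NoDup_app_remove_r _ _ N).
    + exact: (NoDup_app_remove_l _ _ N).
  - case=> <-. exact: teq_refl.
  - case=> <-. exact: (teq_sym (teq_one (LP false))).
Qed.

Lemma teq_pcons l w : teq (Prod (term_of_letter l) (term_of_word w)) (term_of_word (pcons l w)).
Proof.
  case: l w => [b x|[]] [|[b' y|[]] w] /=; try exact: teq_refl.
  - apply: teq_trans (teq_sym (teq_assoc _ _ _)) _.
    exact: teq_trans (teq_Prod teq_Antip_Pivot (teq_refl _)) (teq_Onel _).
  - apply: teq_trans (teq_sym (teq_assoc _ _ _)) _.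
    exact: teq_trans (teq_Prod teq_Pivot_Antip (teq_refl _)) (teq_Onel _).
Qed.

Lemma teq_reduce w : teq (term_of_word w) (term_of_word (reduce w)).
Proof.
  elim: w => [|l w IH] /=; first exact: teq_refl.
  exact: teq_trans (teq_Prod (teq_refl _) IH) (teq_pcons _ _).
Qed.

Definition veq (a : ty) (v v' : val a) := transports (a := a) (b := a) id_ v v'.

Lemma veq_pair a b (v v' : val a) (w w' : val b) :
  veq v v' -> veq w w' -> veq (a := tT a b) (v, w) (v', w').
Proof. move=> A B. have := transports_tens A B. by rewrite tens11. Qed.

Lemma veq_reduce a (w : wval a) : veq (val_of_words w) (val_of_words (words_map reduce w)).
Proof.
  elim: a w => [|/=|a IHa b IHb] w; [exact: transports_id|exact: teq_reduce|].
  exact: (veq_pair (IHa w.1) (IHb w.2)).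
Qed.

Lemma veq_words_of_val fl a (v : val a) w : (fl = true -> S_antimul) -> NoDup (vars v) ->
  words_of_val fl v = Some w -> veq v (val_of_words w).
Proof.
  move=> Hfl. elim: a v w => [|/=|a IHa b IHb] v w.
  - move=> _ [<-]. exact: transports_id.
  - exact: teq_word_of.
  - case: v => [v1 v2] N /=. case E1: (words_of_val _ v1) => [w1|//]. case E2:
      (words_of_val _ v2) => [w2|//] [<-].
    apply: (veq_pair (IHa _ _ _ E1) (IHb _ _ _ E2)).
    + exact: (NoDup_app_remove_r _ _ N).
    + exact: (NoDup_app_remove_l _ _ N).
Qed.

Lemma NoDup_disjoint (l l' : list nat) z : NoDup (l ++ l') -> In z l -> ~ In z l'.
Proof.
  elim: l => [//|k l IH] /= /NoDup_cons_iff [P Q] [E|I] J.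
  - subst k. apply: P. apply/in_or_app. by right.
  - exact: IH.
Qed.

Lemma NoDup_disjoint' (l l' : list nat) z : NoDup (l ++ l') -> In z l' -> ~ In z l.
Proof. move=> N I J. exact: NoDup_disjoint N J I. Qed.

(** * Cancelling a component against the antipode of its neighbour *)

Section Cancel.
Variables (x y : nat).
Hypothesis xy : x <> y.

(* [v] differs from [v'] by a factor that is built from the two halves of one coproduct
   and reduces to [u ∘ e]. *)
Definition cancels (a : ty) (v v' : val a) := exists b (w : val b) (f : Hom (ty_ob b) (ty_ob a)),
  In x (vars w) /\ ~ In y (vars w) /\ splits (merge_at x y) f w v /\ splits (kill_at x) f w v'.

Lemma merge_at_x : merge_at x y x = [x; y].
Proof. by rewrite /merge_at Nat.eqb_refl. Qed.
Lemma merge_at_out z : z <> x -> merge_at x y z = [z].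
Proof. by move/Nat.eqb_neq; rewrite /merge_at => ->. Qed.
Lemma kill_at_x z : kill_at z z = [].
Proof. by rewrite /kill_at Nat.eqb_refl. Qed.
Lemma kill_at_out z z' : z' <> z -> kill_at z z' = [z'].
Proof. by move/Nat.eqb_neq; rewrite /kill_at => ->. Qed.

Lemma cancels_transports a b (f f' : Hom (ty_ob a) (ty_ob b)) v v' w w' :
  f = f' -> cancels v v' -> transports f v w -> transports f' v' w' -> cancels w w'.
Proof.
  move=> E [c [z [h [I [N [A B]]]]]] F G. subst f'.
  exists c, z, (f ∘ h). split => //. split => //. split;
      [exact: splits_transports A F|exact: splits_transports B G].
Qed.

Lemma cancels_tens_r a b (v v' : val a) (r : val b) :
  ~ In x (vars r) -> ~ In y (vars r) -> cancels v v' -> cancels (a := tT a b) (v, r) (v', r).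
Proof.
  move=> Nx Ny [c [z [h [I [N [A B]]]]]].
  exists (tT c b), (z, r), (h ⊠ id_). split; first by apply/in_or_app; left. split.
  { move=> J. by case: (in_app_or _ _ _ J). }
  split.
  - apply: splits_tens A _. apply: splits_triv (transports_id _) => t J. apply: merge_at_out =>
      F. by subst t.
  - apply: splits_tens B _. apply: splits_triv (transports_id _) => t J. apply: kill_at_out => F.
      by subst t.
Qed.

Lemma cancels_tens_l a b (v v' : val a) (r : val b) :
  ~ In x (vars r) -> ~ In y (vars r) -> cancels v v' -> cancels (a := tT b a) (r, v) (r, v').
Proof.
  move=> Nx Ny [c [z [h [I [N [A B]]]]]].
  exists (tT b c), (r, z), (id_ ⊠ h). split; first by apply/in_or_app; right. split.
  { move=> J. by case: (in_app_or _ _ _ J). }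
  split.
  - apply: splits_tens _ A. apply: splits_triv (transports_id _) => t J. apply: merge_at_out =>
      F. by subst t.
  - apply: splits_tens _ B. apply: splits_triv (transports_id _) => t J. apply: kill_at_out => F.
      by subst t.
Qed.

Notation cancels_term := (cancels (a := tX)).

Lemma cancels_teq (t t' s s' : term) : teq t s -> cancels_term t t' -> teq t' s' -> cancels_term
    s s'.
Proof. move=> A B C. exact: (cancels_transports (a := tX) (b := tX) eq_refl B A C). Qed.

Lemma cancels_Antip (t t' : term) : cancels_term t t' -> cancels_term (Antip t) (Antip t').
Proof. move=> B. exact: (cancels_transports (a := tX) (b := tX) eq_refl B (transports_S _)
    (transports_S _)). Qed.

Lemma cancels_Prodr (t t' r : term) : ~ In x (term_vars r) -> ~ In y (term_vars r) ->
  cancels_term t t' -> cancels_term (Prod t r) (Prod t' r).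
Proof.
  move=> Nx Ny A. have B := cancels_tens_r (a := tX) (b := tX) Nx Ny A.
  exact: (cancels_transports (a := tT tX tX) (b := tX) eq_refl B (transports_m _ _)
      (transports_m _ _)).
Qed.

Lemma cancels_Prodl (t t' r : term) : ~ In x (term_vars r) -> ~ In y (term_vars r) ->
  cancels_term t t' -> cancels_term (Prod r t) (Prod r t').
Proof.
  move=> Nx Ny A. have B := cancels_tens_l (a := tX) (b := tX) Nx Ny A.
  exact: (cancels_transports (a := tT tX tX) (b := tX) eq_refl B (transports_m _ _)
      (transports_m _ _)).
Qed.

(** The common source is the unsplit variable [x] under one morphism: written as [m ∘ (f ∘ D)] it
    doubles [x] and yields the product, written as [u ∘ e] it deletes [x] and yields the unit. *)
Lemma cancels_base (f : Hom (H ⊗ H) (H ⊗ H)) (v : val (tT tX tX)) :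
  m ∘ (f ∘ D) = u ∘ e ->
  transports (a := tT tX tX) (b := tT tX tX) f (Var x, Var y) v -> cancels_term (Prod v.1 v.2)
      One.
Proof.
  move=> E A. exists tX, (Var x), (m ∘ (f ∘ D)). split; first by left.
  split; first by move=> /= [F|//]; exact: xy.
  split.
  - rewrite -compA.
    refine (splits_transports (b := tT tX tX) (splits_D_var merge_at_x) _).
    refine (transports_comp (b := tT tX tX) A _). case: v {A} => v1 v2. exact: transports_m.
  - rewrite E. refine (splits_transports (b := tI) (v' := tt) _ transports_u).
    apply: splits_kill => z [<-|//]. exact: kill_at_x.
Qed.

Lemma cancels_xSy : cancels_term (Prod (Var x) (Antip (Var y))) One.
Proof.
  apply: (cancels_base (f := id_ ⊠ S) (v := (Var x, Antip (Var y)))).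
  - by rewrite -compA (h_antir _ _ _ _ _ _ HH).
  - exact: (transports_tens (a := tX) (b := tX) (a' := tX) (b' := tX) (transports_id _)
      (transports_S _)).
Qed.

Lemma cancels_Sxy : cancels_term (Prod (Antip (Var x)) (Var y)) One.
Proof.
  apply: (cancels_base (f := S ⊠ id_) (v := (Antip (Var x), Var y))).
  - by rewrite -compA (h_antil _ _ _ _ _ _ HH).
  - exact: (transports_tens (a := tX) (b := tX) (a' := tX) (b' := tX) (transports_S _)
      (transports_id _)).
Qed.

Lemma NoDup_xy : NoDup [x; y].
Proof. constructor; [by move=> [F|//]; apply: xy|by constructor; [|constructor]]. Qed.
(** Applying S to the cancellation of x S(y) gives that of S(S(y)) S(x). Multiply by p on the left
    and use p S(S(y)) = y p. *)
Lemma cancels_ypSx : S_antimul -> cancels_term (Prod (Var y) (Prod Pivot (Antip (Var x)))) Pivot.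
Proof.
  move=> A.
  have B : cancels_term (Prod Pivot (Antip (Prod (Var x) (Antip (Var y)))))
      (Prod Pivot (Antip One)).
  { apply: cancels_Prodl => //. apply: cancels_Antip. exact: cancels_xSy. }
  refine (cancels_teq _ B _); last exact: teq_trans (teq_Prod (teq_refl _) teq_Antip_One)
      (teq_Oner _).
  apply: teq_trans (teq_Prod (teq_refl _) (teq_anti (t1 := Var x) (t2 := Antip (Var y)) A
      NoDup_xy)) _.
  apply: teq_trans (teq_Prod (teq_refl _) (teq_Prod (teq_Antip_Antip _) (teq_refl _))) _.
  apply: teq_trans (teq_Prod (teq_refl _) (teq_assoc _ _ _)) _.
  apply: teq_trans (teq_sym (teq_assoc _ _ _)) _.
  apply: teq_trans (teq_Prod teq_Pivot_Antip (teq_refl _)) _.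
  exact: teq_trans (teq_Onel _) (teq_assoc _ _ _).
Qed.

(** Applying S to the cancellation of S(x) y gives that of S(y) S(S(x)). Multiply by S(p) on the
    right and use S(S(x)) = S(p) x p. *)
Lemma cancels_Sypx : S_antimul -> cancels_term (Prod (Antip (Var y))
    (Prod (Antip Pivot) (Var x))) (Antip Pivot).
Proof.
  move=> A.
  have B : cancels_term (Prod (Antip (Prod (Antip (Var x)) (Var y))) (Antip Pivot))
      (Prod (Antip One) (Antip Pivot)).
  { apply: cancels_Prodr => //. apply: cancels_Antip. exact: cancels_Sxy. }
  refine (cancels_teq _ B _); last exact: teq_trans (teq_Prod teq_Antip_One (teq_refl _))
      (teq_Onel _).
  apply: teq_trans (teq_Prod (teq_anti (t1 := Antip (Var x)) (t2 := Var y) A NoDup_xy)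
      (teq_refl _)) _.
  apply: teq_trans (teq_assoc _ _ _) _. apply: teq_Prod (teq_refl _) _.
  apply: teq_trans (teq_Prod (teq_Antip_Antip _) (teq_refl _)) _.
  apply: teq_trans (teq_assoc _ _ _) _. apply: teq_Prod (teq_refl _) _.
  apply: teq_trans (teq_assoc _ _ _) _.
  exact: teq_trans (teq_Prod (teq_refl _) teq_Pivot_Antip) (teq_Oner _).
Qed.

Lemma cancels_cancel_hd fl w w' : (fl = true -> S_antimul) -> NoDup (term_vars (term_of_word w))
    ->
  cancel_hd fl x y w = Some w' -> cancels_term (term_of_word w) (term_of_word w').
Proof.
  move=> Hfl.
  have OK t (W : list letter) (c : term) : NoDup (term_vars t ++ term_vars (term_of_word W)) ->
    In x (term_vars t) -> In y (term_vars t) -> cancels_term t c -> cancels_term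
        (Prod t (term_of_word W)) (Prod c (term_of_word W)).
  { move=> N Ix Iy. by apply: cancels_Prodr; apply: (NoDup_disjoint N). }
  have AS t1 t2 c (W : list letter) : cancels_term (Prod (Prod t1 t2) (term_of_word W))
      (Prod c (term_of_word W)) ->
    cancels_term (Prod t1 (Prod t2 (term_of_word W))) (Prod c (term_of_word W)).
  { move=> B. exact: (cancels_teq (teq_assoc _ _ _) B (teq_refl _)). }
  have U t (W : list letter) : cancels_term t (Prod One (term_of_word W)) -> cancels_term t
      (term_of_word W).
  { move=> B. exact: (cancels_teq (teq_refl _) B (teq_Onel _)). }
  have EQ z z' : Nat.eqb z z' = true -> z = z' by move/Nat.eqb_eq.
  case: w => [//|[b1 z1|b1] [|[b2 z2|b2] w]] N; try by case: b1 N.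
  - case: b1 b2 N => [] [] //= N; case C: (_ && _) => //; case=> <-;
      case/andb_prop: C => /EQ E1 /EQ E2; subst z1 z2; apply: U; apply: AS; apply: OK => //=;
      try (by left); try (by right; left); [exact: cancels_Sxy|exact: cancels_xSy].
  - case: b1 b2 N => [] [] //=; case: w => [//|[[] z3|b3] w] //= N; case C: (_ && _) => //;
      case=> <-;
      case/andb_prop: C => /andb_prop [/Hfl A /EQ E1] /EQ E2; subst z1 z3.
    + refine (cancels_teq _ (OK (Prod (Antip (Var y)) (Prod (Antip Pivot) (Var x))) w
        (Antip Pivot) _ _ _ (cancels_Sypx A)) (teq_refl _)) => //=;
        try (by left); try (by right; left).
      exact: teq_trans (teq_assoc _ _ _) (teq_Prod (teq_refl _) (teq_assoc _ _ _)).
    + refine (cancels_teq _ (OK (Prod (Var y) (Prod Pivot (Antip (Var x)))) w Pivot _ _ _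
        (cancels_ypSx A)) (teq_refl _)) => //=;
        try (by left); try (by right; left).
      exact: teq_trans (teq_assoc _ _ _) (teq_Prod (teq_refl _) (teq_assoc _ _ _)).
Qed.

Lemma cancels_names a (v v' : val a) : cancels v v' -> In x (vars v) /\ In y (vars v).
Proof.
  move=> [c [z [h [I [_ [[P _] _]]]]]].
  split; apply: (Permutation_in _ P); apply/in_flat_map; exists x; rewrite merge_at_x; split =>
      //.
  - by left.
  - by right; left.
Qed.

Lemma cancels_cancel_w fl w w' : (fl = true -> S_antimul) -> NoDup (term_vars (term_of_word w)) ->
  cancel_w fl x y w = Some w' -> cancels_term (term_of_word w) (term_of_word w').
Proof.
  move=> Hfl. elim: w w' => [|l w IH] w' N; first by [].
  change (cancel_w fl x y (l :: w)) with
    (match cancel_hd fl x y (l :: w) with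
     | Some w1 => Some w1
     | None => match cancel_w fl x y w with Some w2 => Some (l :: w2) | None => None end
     end).
  case C: (cancel_hd _ _ _ _) => [w1|].
  - case=> <-. exact: cancels_cancel_hd N C.
  - case E: (cancel_w _ _ _ w) => [w1|//] [<-].
    have {}IH := IH _ (NoDup_app_remove_l _ _ N) E.
    have [Ix Iy] := cancels_names IH.
    apply: cancels_Prodl => //; exact: (NoDup_disjoint' N).
Qed.

Lemma cancels_cancel fl a (w w' : wval a) : (fl = true -> S_antimul) -> NoDup
    (vars (val_of_words w)) ->
  cancel fl x y w = Some w' -> cancels (val_of_words w) (val_of_words w').
Proof.
  move=> Hfl. elim: a w w' => [//|/=|a IHa b IHb] w w'; first exact: cancels_cancel_w.
  case: w => [w1 w2] N /=. case E1: (cancel _ _ _ w1) => [v1|].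
  - case=> <-. have A := IHa _ _ (NoDup_app_remove_r _ _ N) E1.
    have [Ix Iy] := cancels_names A. by apply: cancels_tens_r => //; exact: (NoDup_disjoint N).
  - case E2: (cancel _ _ _ w2) => [v2|//] [<-]. have A := IHb _ _ (NoDup_app_remove_l _ _ N) E2.
    have [Ix Iy] := cancels_names A. by apply: cancels_tens_l => //; exact: (NoDup_disjoint' N).
Qed.

Lemma kill_merge l : ~ In y l -> flat_map (kill_at y) (flat_map (merge_at x y) l) = l.
Proof.
  elim: l => [//|z l IH] N /=. rewrite flat_map_app IH; first by move=> F; apply: N; right.
  case: (Nat.eq_dec z x) => [->|Nz].
  - rewrite merge_at_x /= kill_at_x kill_at_out //.
  - rewrite merge_at_out //= kill_at_out // => F. apply: N. by left.
Qed.

(** Both sides come from one expression over the splitting without [y], followed by one morphism: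
    doubling [x] recovers [s] and [v], deleting [x] gives the shorter splitting and [v']. *)
Lemma step_cancels a c (s : splitting c) (v v' : val a) :
  cancels v v' -> resplit_map (merge_at x y) (resplit_map (kill_at y) s) = s ->
  NoDup (names (resplit_map (kill_at x) (resplit_map (kill_at y) s))) ->
  step (id_) s v (resplit_map (kill_at x) (resplit_map (kill_at y) s)) v'.
Proof.
  move=> A E N' q r N P. split => //.
  have [Ix Iy] := cancels_names A.
  have ND := Permutation_NoDup P N.
  have := cancels_tens_r (NoDup_disjoint ND Ix) (NoDup_disjoint ND Iy) A.
  case=> [b [w [f [_ [Ny [B C]]]]]].
  have Pw : Permutation (names (resplit_map (kill_at y) s)) (vars w).
  { rewrite names_resplit_map -(kill_merge Ny). apply: Permutation_flat_map.
    rewrite P. case: B => B _. by symmetry. }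
  have N0 : NoDup (flat_map (merge_at x y) (names (resplit_map (kill_at y) s))) by rewrite
      -names_resplit_map E.
  have [_ E1] := sem_splits B Pw N0.
  have N1 : NoDup (flat_map (kill_at x) (names (resplit_map (kill_at y) s))) by rewrite
      -names_resplit_map.
  have [P2 E2] := sem_splits C Pw N1.
  split => //. by rewrite tens11 comp1f -E2 E1 E.
Qed.
End Cancel.

(** * Soundness of normalisation, of runs and of the equality check *)

Lemma step_veq a c (s : splitting c) (v v' : val a) : (NoDup (vars v) -> veq v v') -> step id_ s
    v s v'.
Proof. exact: step_transports. Qed.

Lemma step_id a c (s : splitting c) (v : val a) : step id_ s v s v.
Proof. apply: step_veq => _. exact: transports_id. Qed.

Lemma step_trans a c (s1 s2 s3 : splitting c) (v1 v2 v3 : val a) :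
  step id_ s1 v1 s2 v2 -> step id_ s2 v2 s3 v3 -> step id_ s1 v1 s3 v3.
Proof. move=> A B. have := step_comp A B. by rewrite comp1f. Qed.

Lemma step_NoDup a b (f : Hom (ty_ob a) (ty_ob b)) c (s s' : splitting c) v v' :
  (NoDup (vars v) -> step f s v s' v') -> step f s v s' v'.
Proof.
  move=> A q r N P. apply: A => //.
  apply: (NoDup_app_remove_r _ (vars r)). exact: (Permutation_NoDup P).
Qed.

Lemma step_try_cancel fl c a l (s s' : splitting c) (w w' : wval a) : (fl = true -> S_antimul) ->
  try_cancel fl l s w = Some (s', w') -> step id_ s (val_of_words w) s' (val_of_words w').
Proof.
  move=> Hfl. elim: l => [//|[x y] l IH] /=.
  case C: (cancel _ _ _ _) => [w1|]; last exact: IH.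
  case xy: (Nat.eqb x y) => //=. move/Nat.eqb_neq: xy => xy.
  case: (spt_eq_dec _ _) => [E|//] /=. case D2: (nodupb _) => //. case=> <- <-.
  apply: step_NoDup => N.
  apply: (step_trans (v2 := val_of_words w1)).
  - by apply: (step_cancels xy (cancels_cancel xy Hfl N C) E); exact: nodupbP.
  - apply: step_veq => _. exact: veq_reduce.
Qed.

Lemma step_cancel_all n fl c a (s : splitting c) (w : wval a) : (fl = true -> S_antimul) ->
  step id_ s (val_of_words w) (cancel_all n fl s w).1 (val_of_words (cancel_all n fl s w).2).
Proof.
  move=> Hfl. elim: n s w => [|n IH] s w /=; first exact: step_id.
  case E: try_cancel => [[s' w']|] /=; last exact: step_id.
  exact: step_trans (step_try_cancel Hfl E) (IH _ _).
Qed.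

Lemma step_normalize fl c a (s : splitting c) (v : val a) : (fl = true -> S_antimul) ->
  step id_ s v (normalize fl s v).1 (normalize fl s v).2.
Proof.
  move=> Hfl. rewrite /normalize. case E: words_of_val => [w|] /=; last exact: step_id.
  have A : step id_ s v s (val_of_words w) by apply: step_veq => N; exact: veq_words_of_val N E.
  have B : step id_ s (val_of_words w) s (val_of_words (words_map reduce w)) by apply: step_veq
      => _; exact: veq_reduce.
  have := @step_cancel_all (length (names s)) fl _ _ s (words_map reduce w) Hfl.
  case: cancel_all => [s' w'] /= X. exact: step_trans A (step_trans B X).
Qed.
Lemma run_step fl (fl_ok : fl = true -> S_anticomul /\ S_antimul) a b (d : dia a b) c
    (s s' : splitting c) v v' :
  run fl d s v = Some (s', v') -> step (denote d) s v s' v'.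
Proof.
  elim: d s s' v v' =>
    [a'|a1 a2 a3 d1 IH1 d2 IH2|a1 a2 a3 a4 d1 IH1 d2 IH2|a1 a2 a3|a1 a2 a3|a1|a1|a1|a1|a1
        a2||||||]
    s s' v v' /=.
  - case=> <- <-. apply: step_transports => _. exact: transports_id.
  - case E2: (run _ d2) => [[s1 v1]|//] E1.
    have N : step id_ s1 v1 (normalize fl s1 v1).1 (normalize fl s1 v1).2.
    { by apply: step_normalize => /fl_ok []. }
    (* The normalisation enters as an identity morphism between the two factors. *)
    rewrite -(comp1f (denote d2)). exact: step_comp (step_comp (IH2 _ _ _ _ E2) N)
        (IH1 _ _ _ _ E1).
  - case E1: (run _ d1) => [[s1 v1]|//]. case E2: (run _ d2) => [[s2 v2]|//] [<- <-].
    rewrite (surjective_pairing v). exact: step_tens (IH1 _ _ _ _ E1) (IH2 _ _ _ _ E2).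
  - case=> <- <-. apply: step_transports => _. case: v => [[? ?] ?]. exact: transports_assoc.
  - case=> <- <-. apply: step_transports => _. case: v => [? [? ?]]. exact: transports_associ.
  - case=> <- <-. apply: step_transports => _. case: v => [[] ?]. exact: transports_lunit.
  - case=> <- <-. apply: step_transports => _. exact: transports_luniti.
  - case=> <- <-. apply: step_transports => _. case: v => [? []]. exact: transports_runit.
  - case=> <- <-. apply: step_transports => _. exact: transports_runiti.
  - case=> <- <-. apply: step_transports. case: v => [? ?]. exact: transports_braid.
  - case=> <- <-. apply: step_transports => _. case: v => [? ?]. exact: transports_m.
  - case=> <- <-. apply: step_transports => _. case: v. exact: transports_u.
  - case F: (_ || _) => //. case R: resplit => [s1|//] [<- <-].
    apply: (step_splits (a := tX) (b := tT tX tX) R) => N.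
    apply: splits_dup => //; last by move=> x I; rewrite subst_on_in.
    case/orb_prop: F => [/fl_ok [? _]|]; by [left|right].
  - case R: resplit => [s1|//] [<- <-].
    apply: (step_splits (a := tX) (b := tI) R) => N.
    apply: splits_kill => x I. by rewrite subst_on_in.
  - case=> <- <-. apply: step_transports => _. exact: transports_S.
  - case=> <- <-. apply: step_transports => _. case: v. exact: transports_p.
Qed.

Lemma init_spec a k : let i := init a k in
  Permutation (names i.1.1) (vars i.1.2) /\ sem i.1.1 i.1.2 = id_.
Proof.
  elim: a k => [||a IHa b IHb] k.
  - split => //. by rewrite /sem /= perm_nil !comp1f.
  - split => //. rewrite /sem perm_id comp1f. exact: runit_icop1.
  - move: (IHa k) => /=. case: (init a k) => [[s1 v1] k1] /= [P1 E1].
    move: (IHb k1) => /=. case: (init b k1) => [[s2 v2] k2] /= [P2 E2].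
    split; first exact: Permutation_app.
    rewrite /sem eval_val_pair split_inputs_pair /= !compA (tail22 (perm_glue P1 P2))
        (tail20 (cut_glue _ _)) !tens_fuse.
    rewrite /sem in E1 E2. by rewrite E1 E2 tens11.
Qed.

Lemma exec_sound fl (fl_ok : fl = true -> S_anticomul /\ S_antimul) a b (d : dia a b) s v :
  exec fl d = Some (s, v) ->
  NoDup (names s) /\ Permutation (names s) (vars v) /\ denote d = sem s v.
Proof.
  rewrite /exec. move: (init_spec a 0). case: (init a 0) => [[s0 v0] k] /= [P0 E0].
  case N0: (nodupb _) => //. move/nodupbP: N0 => N0.
  case R: run => [[s1 v1]|//] E.
  have A := run_step fl_ok R.
  have B : step id_ s1 v1 s v.
  { have := @step_normalize fl _ _ s1 v1. case: E => ->. apply. by move/fl_ok => []. }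
  have := step_comp A B. rewrite comp1f => {}A.
  (* The run is instantiated with the unit object as bystander, which the right unitor then
     removes. *)
  have P0' : Permutation (names s0) (vars v0 ++ vars (tt : val tI)) by rewrite app_nil_r.
  have [N [P]] := A tI tt N0 P0'.
  have [P1 F1] := sem_transports (transports_runit v) P.
  have [_ F0] := sem_transports (transports_runit v0) P0'.
  move=> F. split => //. split => //.
  by rewrite -F1 -F /= (tail22 (runit_natural _)) F0 E0 compf1.
Qed.

(** A renaming is a splitting of every component into a single one, so [sem_splits] also yields
    invariance under renaming. *)
Lemma splits_rename_term r (t : term) :
  splits (a := tX) (b := tX) (fun x => [r x]) (idm H) t (rename_term r t).
Proof.
  elim: t => [x|t [P E]|t1 IH1 t2 IH2||].
  - split => //. change (vars (a := tX) (Var x)) with [x].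
    have G : (fun x => [r x]) x = [r x] by []. rewrite (perm_split_wires1 G) comp1f.
    rewrite -compA. change (eval_val (rename_term r (Var x) : val tX)) with (runit H). by rewrite
        runit_icop1 comp1f.
  - split; first exact: P. rewrite comp1f in E. rewrite comp1f /= {1}[eval_term t]E. by rewrite
      !compA.
  - have [P E] : splits (a := tT tX tX) (b := tX) (fun x => [r x]) (m ∘ (id_ ⊠ id_)) (t1, t2)
      (Prod (rename_term r t1) (rename_term r t2)).
    { exact: (splits_transports (b := tT tX tX) (splits_tens (a := tX) (b := tX) (a' := tX)
        (b' := tX) IH1 IH2) (transports_m _ _)). }
    split; first exact: P. by rewrite -E tens11 compf1 comp1f.
  - split => //=. by rewrite perm_nil !compf1 comp1f.
  - split => //=. by rewrite perm_nil !compf1 comp1f.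
Qed.

Lemma splits_rename_val r a (v : val a) : splits (a := a) (b := a) (fun x => [r x]) id_ v
    (rename_val r v).
Proof.
  elim: a v => [|/=|a IHa b IHb] v.
  - split => //=. by rewrite perm_nil !compf1.
  - exact: splits_rename_term.
  - have := splits_tens (IHa v.1) (IHb v.2). rewrite tens11. by case: v.
Qed.

Lemma same_sound c a (s s' : splitting c) (v v' : val a) :
  Permutation (names s) (vars v) -> same s v s' v' = true -> sem s v = sem s' v'.
Proof.
  move=> P. rewrite /same. case N: (nodupb _) => //=.
  case: spt_eq_dec => //= E1. case: val_eq_dec => //= E2 _.
  move/nodupbP: N => N. rewrite -E1 names_resplit_map in N.
  have [_ E] := sem_splits (splits_rename_val (table (names s) (names s')) v) P N.
  by rewrite -E1 -E2 -E comp1f.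
Qed.

Lemma check_sound fl (fl_ok : fl = true -> S_anticomul /\ S_antimul) a b (d d' : dia a b) :
  check fl d d' = true -> denote d = denote d'.
Proof.
  rewrite /check. case E: exec => [[s v]|//]. case E': exec => [[s' v']|//] C.
  have [_ [P ->]] := exec_sound fl_ok E. have [_ [_ ->]] := exec_sound fl_ok E'.
  exact: same_sound.
Qed.

(** * The antipode reverses products and coproducts *)

(** In the convolution monoid of maps from [C] to [A]: f = f ⋆ (g ⋆ h) = (f ⋆ g) ⋆ h = h. *)
Lemma convolution_inverse_unique (C A : K) (Dl : Hom C (C ⊗ C)) (ep : Hom C unitob)
    (mu : Hom (A ⊗ A) A) (et : Hom unitob A) (f g h : Hom C A) :
  assoc C C C ∘ (Dl ⊠ id_) ∘ Dl = (id_ ⊠ Dl) ∘ Dl ->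
  (ep ⊠ id_) ∘ Dl = luniti C -> (id_ ⊠ ep) ∘ Dl = runiti C ->
  mu ∘ (mu ⊠ id_) = mu ∘ (id_ ⊠ mu) ∘ assoc A A A ->
  mu ∘ (et ⊠ id_) = lunit A -> mu ∘ (id_ ⊠ et) = runit A ->
  mu ∘ (f ⊠ g) ∘ Dl = et ∘ ep -> mu ∘ (g ⊠ h) ∘ Dl = et ∘ ep -> f = h.
Proof.
  move=> CA CL CR MA ML MR FG GH.
  rewrite !compA in CA. rewrite !compA in MA. rewrite !compA in FG. rewrite !compA in GH.
  have E1 : mu ∘ ((f ⊠ (mu ∘ ((g ⊠ h) ∘ Dl))) ∘ Dl) = f.
  { have -> : f ⊠ (mu ∘ ((g ⊠ h) ∘ Dl)) = (id_ ⊠ et) ∘ ((f ⊠ id_) ∘ (id_ ⊠ ep)).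
    { by rewrite GH !tens_fuse !comp1f compf1. }
    by rewrite !compA CR runiti_natural (tail21 MR) (tail20 (runitK _)). }
  have E2 : mu ∘ (((mu ∘ ((f ⊠ g) ∘ Dl)) ⊠ h) ∘ Dl) = h.
  { have -> : (mu ∘ ((f ⊠ g) ∘ Dl)) ⊠ h = (et ⊠ id_) ∘ ((id_ ⊠ h) ∘ (ep ⊠ id_)).
    { by rewrite FG !tens_fuse !comp1f compf1. }
    by rewrite !compA CL luniti_natural (tail21 ML) (tail20 (lunitK _)). }
  apply: (eq_trans (eq_sym E1)). apply: (eq_trans _ E2).
  have -> : (mu ∘ ((f ⊠ g) ∘ Dl)) ⊠ h = (mu ⊠ id_) ∘ (((f ⊠ g) ⊠ h) ∘ (Dl ⊠ id_)).
  { by rewrite !tens_fuse comp1f compf1. }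
  have -> : f ⊠ (mu ∘ ((g ⊠ h) ∘ Dl)) = (id_ ⊠ mu) ∘ ((f ⊠ (g ⊠ h)) ∘ (id_ ⊠ Dl)).
  { by rewrite !tens_fuse comp1f compf1. }
  rewrite !compA -CA (tail23 MA). by rewrite (tail22 (assoc_natural _ _ _)).
Qed.

Lemma denote_eq_without_anti a b (d d' : dia a b) : check false d d' = true -> denote d = denote
    d'.
Proof. exact: check_sound. Qed.

Section Anti.
Notation X := (tX : Free).

Let msX : dia (tT (tT tX tX) (tT tX tX)) (tT (tT tX tX) (tT tX tX)) := ms (K := Free) X X X X.
Let D2 : dia (tT tX tX) (tT (tT tX tX) (tT tX tX)) := dComp msX (dTens dD dD).
Let e2 : dia (tT tX tX) tI := dComp (dLunit tI) (dTens dE dE).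
Let m2 : dia (tT (tT tX tX) (tT tX tX)) (tT tX tX) := dComp (dTens dM dM) msX.
Let u2 : dia tI (tT tX tX) := dComp (dTens dU dU) (dLuniti tI).
Let XX := tT tX tX.

(** Both sides are convolution inverses of [m] among maps from [H ⊗ H] to [H]. The inverse on the
    right applies S to variables only, so execution without the flag verifies it; the one involving
    [S ∘ m] follows from [h_Dm] and the antipode axiom. *)
Lemma antimul_S : S_antimul.
Proof.
  apply: (convolution_inverse_unique (Dl := denote D2) (ep := denote e2) (mu := m) (et := u)
      (g := m)).
  - exact: (denote_eq_without_anti (d := dComp (dComp (dAssoc XX XX XX) (dTens D2 (dId XX))) D2)
      (d' := dComp (dTens (dId XX) D2) D2)).
  - exact: (denote_eq_without_anti (d := dComp (dTens e2 (dId XX)) D2) (d' := dLuniti XX)).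
  - exact: (denote_eq_without_anti (d := dComp (dTens (dId XX) e2) D2) (d' := dRuniti XX)).
  - exact: (h_assoc _ _ _ _ _ _ HH).
  - exact: mul_unitl.
  - exact: mul_unitr.
  - change (m ∘ ((S ∘ m) ⊠ m) ∘ (ms H H H H ∘ (D ⊠ D)) = u ∘ (lunit unitob ∘ (e ⊠ e))).
    have -> : (S ∘ m) ⊠ m = (S ⊠ id_) ∘ (m ⊠ m) by rewrite tens_fuse comp1f.
    rewrite -(h_em _ _ _ _ _ _ HH) -(compA u) -(h_antil _ _ _ _ _ _ HH).
    rewrite !compA (h_Dm _ _ _ _ _ _ HH). by rewrite !compA.
  - exact: (denote_eq_without_anti (d := dComp (dComp dM
      (dTens dM (dComp dM (dComp (dTens dS dS) (dBraid tX tX))))) D2)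
      (d' := dComp dU e2)).
Qed.

(** Dually, both sides are convolution inverses of [D] among maps from [H] to [H ⊗ H]. *)
Lemma anticomul_S : S_anticomul.
Proof.
  apply: (convolution_inverse_unique (Dl := D) (ep := e) (mu := denote m2) (et := denote u2)
      (g := D)).
  - exact: (h_coassoc _ _ _ _ _ _ HH).
  - exact: (h_counitl _ _ _ _ _ _ HH).
  - exact: (h_counitr _ _ _ _ _ _ HH).
  - exact: (denote_eq_without_anti (d := dComp m2 (dTens m2 (dId XX)))
      (d' := dComp (dComp m2 (dTens (dId XX) m2)) (dAssoc XX XX XX))).
  - exact: (denote_eq_without_anti (d := dComp m2 (dTens u2 (dId XX))) (d' := dLunit XX)).
  - exact: (denote_eq_without_anti (d := dComp m2 (dTens (dId XX) u2)) (d' := dRunit XX)).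
  - change ((m ⊠ m) ∘ ms H H H H ∘ ((D ∘ S) ⊠ D) ∘ D = (u ⊠ u) ∘ luniti unitob ∘ e).
    have -> : (D ∘ S) ⊠ D = (D ⊠ D) ∘ (S ⊠ id_) by rewrite tens_fuse compf1.
    rewrite -(h_Du _ _ _ _ _ _ HH) (compA D) -(h_antil _ _ _ _ _ _ HH) -(compA _ (D ⊠ D))
        -(h_Dm _ _ _ _ _ _ HH).
    by rewrite !compA.
  - exact: (denote_eq_without_anti (d := dComp (dComp m2
      (dTens dD (dComp (dTens dS dS) (dComp (dBraid tX tX) dD)))) dD)
      (d' := dComp u2 dE)).
Qed.
End Anti.

Lemma denote_eq a b (d d' : dia a b) : check true d d' = true -> denote d = denote d'.
Proof.
  apply: check_sound => _. split; [exact: anticomul_S|exact: antimul_S].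
Qed.

(** * The slides *)

Local Notation X := (tX : Free).
Local Notation DA := (slide_a (K := Free) X dM dD dS).
Local Notation DB := (slide_b (K := Free) X dM dD).
Local Notation RV := (rho_v (K := Free) X dM dD dS).
Local Notation DF := (delta_f (K := Free) X dM dD dS dP).
Local Notation id1 := (dTens (dId tX)).

Local Notation Da := (slide_a H m D S).
Local Notation Db := (slide_b H m D).
Local Notation Da' := (slide_a H m D (idm H)).
(* [T x * S p] is the inverse antipode of [x]. *)
Definition S_inverse : Hom H H := m ∘ (Tpiv H m S p ⊠ (S ∘ p)) ∘ runiti H.
Local Notation Db' := (slide_b H (m ∘ (S_inverse ⊠ idm H)) D).
Local Notation act := (rho_v H m D S).
Local Notation coact := (delta_f H m D S p).

(** With the identity in place of S the slide multiplies b by the component of a itself. In either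
    order of composition, b is followed by a component next to the antipode of its neighbour. *)
Lemma slide_a_inverse : is_inverse Da Da'.
Proof.
  split.
  (* The denotations are convertible to the two sides of the goal, so only the boolean check is left
     to evaluate. *)
  - refine (denote_eq (d := dComp (slide_a (K := Free) X dM dD (dId tX)) DA)
      (d' := dId (tT tX tX)) _); by vm_compute.
  - refine (denote_eq (d := dComp DA (slide_a (K := Free) X dM dD (dId tX)))
      (d' := dId (tT tX tX)) _); by vm_compute.
Qed.

(** The inverse antipode is p S(x) S(p). The words that arise are p S(b_(2)) S(p) b_(1) and b_(2) p
    S(b_(1)) S(p), which is where the patterns of [cancel_hd] with a pivotal letter in the middle
    are needed. *)
Lemma slide_b_inverse : is_inverse Db Db'.
Proof.
  pose SI := dComp (dComp dM (dTens (Tpiv (K := Free) X dM dS dP) (dComp dS dP))) (dRuniti tX).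
  pose DB' := slide_b (K := Free) X (dComp dM (dTens SI (dId tX))) dD.
  split.
  - refine (denote_eq (d := dComp DB' DB) (d' := dId (tT tX tX)) _); by vm_compute.
  - refine (denote_eq (d := dComp DB DB') (d' := dId (tT tX tX)) _); by vm_compute.
Qed.

(** Both composites send a ⊗ b to b_(2) ⊗ b_(3) S(a) S(b_(1)). *)
Lemma slide_braid : Da ∘ (Db ∘ Da) = Db ∘ (Da ∘ Db).
Proof. exact: (denote_eq (d := dComp DA (dComp DB DA)) (d' := dComp DB (dComp DA DB))). Qed.

Lemma slide_a_YD : is_YD_morphism H m D S p Da.
Proof.
  split.
  - refine (denote_eq (d := dComp DA RV) (d' := dComp RV (id1 DA)) _); by vm_compute.
  - refine (denote_eq (d := dComp DF DA) (d' := dComp (id1 DA) DF) _); by vm_compute.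
Qed.

Lemma slide_b_YD : is_YD_morphism H m D S p Db.
Proof.
  split.
  - refine (denote_eq (d := dComp DB RV) (d' := dComp RV (id1 DB)) _); by vm_compute.
  - refine (denote_eq (d := dComp DF DB) (d' := dComp (id1 DB) DF) _); by vm_compute.
Qed.

(* The full twist [(BAB)^4] is the Dehn twist along the boundary: it lets [T] of the
   coaction act. *)
Lemma slide_full_twist :
  Db ∘ (Da ∘ (Db ∘ (Db ∘ (Da ∘ (Db ∘ (Db ∘ (Da ∘ (Db ∘ (Db ∘ (Da ∘ Db))))))))))
  = act ∘ ((Tpiv H m S p ⊠ idm (H ⊗ H)) ∘ coact).
Proof.
  refine (denote_eq
    (d := dComp DB (dComp DA (dComp DB (dComp DB (dComp DA (dComp DB (dComp DB (dComp DA
            (dComp DB (dComp DB (dComp DA DB)))))))))))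
    (d' := dComp RV (dComp (dTens (Tpiv (K := Free) X dM dS dP) (dId (tT tX tX))) DF)) _); by
        vm_compute.
Qed.

(** This says that the counit of T(1) = p is 1. *)
Lemma triv_act_coact :
  triv_act H e ∘ ((Tpiv H m S p ⊠ idm (H ⊗ H)) ∘ triv_coact H u) = id_.
Proof.
  refine (denote_eq
    (d := dComp (triv_act (K := Free) X dE)
      (dComp (dTens (Tpiv (K := Free) X dM dS dP) (dId (tT tX tX)))
          (triv_coact (K := Free) X dU)))
    (d' := dId (tT tX tX)) _); by vm_compute.
Qed.

Lemma triv_coact_nat (f : Hom (H ⊗ H) (H ⊗ H)) :
  (id_ ⊠ f) ∘ triv_coact H u = triv_coact H u ∘ f.
Proof. by rewrite /triv_coact -compA -tens_rl tens_lr !compA luniti_natural. Qed.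

Lemma triv_act_nat (f : Hom (H ⊗ H) (H ⊗ H)) :
  triv_act H e ∘ (id_ ⊠ f) = f ∘ triv_act H e.
Proof. by rewrite /triv_act compA -tens_lr tens_rl -!compA lunit_natural. Qed.

(* Stated for variables, since [delta_f] and [rho_v] are themselves composites. *)
Lemma sandwich (E X Y Y' Q : K) (i : Hom E X) (q : Hom X Q) (d d' : Hom X Y)
    (a a' : Hom Y' X) (t : Hom Y Y') :
  d ∘ i = d' ∘ i -> q ∘ a = q ∘ a' -> a' ∘ (t ∘ d') = id_ ->
  (q ∘ (a ∘ (t ∘ d))) ∘ i = q ∘ i.
Proof.
  move=> Ei Eq Et. by rewrite !compA Ei (tail22 Eq) (tail31 Et) comp1f.
Qed.

Lemma YD_inverse f f' : is_inverse f f' ->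
  is_YD_morphism H m D S p f -> is_YD_morphism H m D S p f'.
Proof.
  move=> [E1 E2] [F G]. split.
  - apply: (split_mono_cancel E1). rewrite (tail20 E2) (tail22 F) tens_fuse E2 comp1f tens11
      compf1. done.
  - apply: (split_epi_cancel E2). rewrite compA E1 compf1 compA G. by rewrite
      (tail20 (tens_inverse (comp1f _) E1)).
Qed.

(** * Homomorphisms out of presented groups *)

Lemma eval_word_app (A : K) (a ai b bi : Hom A A) w w' :
  eval_word a ai b bi (w ++ w') = eval_word a ai b bi w ∘ eval_word a ai b bi w'.
Proof.
  elim: w => [|l w IH]; first by rewrite comp1f.
  by rewrite /= /eval_word /= in IH *; rewrite IH compA.
Qed.

Lemma defines_hom_of_rels (A : K) rels (a ai b bi : Hom A A) :
  is_inverse a ai -> is_inverse b bi ->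
  (forall r r', In (r, r') rels -> eval_word a ai b bi r = eval_word a ai b bi r') ->
  defines_hom rels a ai b bi.
Proof.
  move=> Ia Ib R. split => //. split => // w w'.
  elim => {w w'} [//|w w' _ -> //|w1 w2 w3 _ -> _ -> //|w1 w1' w2 w2' _ E1 _ E2|x c|r r' I].
  - by rewrite !eval_word_app E1 E2.
  - case: Ia => [a1 a2]. case: Ib => [b1 b2].
    by case: x; case: c; rewrite /eval_word /= compf1.
  - exact: R.
Qed.

(** * Descent to the image of the coinvariants in the quotient *)

Section Invariants.
Variables (E : K) (iota : Hom E (H ⊗ H)) (Q : K) (pi : Hom (H ⊗ H) Q).
Variables (Inv : K) (ei : Hom E Inv) (j : Hom Inv Q).
Hypothesis Hiota : is_equaliser iota coact (triv_coact H u).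
Hypothesis Hpi : is_coequaliser pi act (triv_act H e).
Hypothesis Himage : is_image (pi ∘ iota) ei j.

Lemma pi_epi (Z : K) (f g : Hom Q Z) : f ∘ pi = g ∘ pi -> f = g.
Proof.
  move=> F. case: Hpi => [C U].
  case: (U Z (f ∘ pi)); first by rewrite !compA C.
  move=> k [_ Uk]. by rewrite -(Uk f) // -(Uk g).
Qed.

(** The equaliser of [f] and [g] is a subobject of [Inv] through which [ei] factors. Minimality of
    the image splits its inclusion, so [f] and [g] agree everywhere. *)
Lemma image_epi : finitely_complete K -> forall (Z : K) (f g : Hom Inv Z), f ∘ ei = g ∘ ei -> f =
    g.
Proof.
  move=> [_ [_ EQ]] Z f g F.
  case: (EQ _ _ f g) => W [i [Ei Ui]].
  case: (Ui _ ei F) => k [Ek _].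
  case: Himage => [Ej [Mj Im]].
  have Mi : is_mono (j ∘ i).
  { move=> W' x y. rewrite !compA => /Mj G.
    case: (Ui W' (i ∘ x)); first by rewrite -!compA Ei.
    move=> z [_ Uz]. by rewrite -(Uz x) // -(Uz y). }
  case: (Im _ k _ Mi); first by rewrite compA Ek.
  move=> r. rewrite compA => R.
  have {}R : i ∘ r = id_ by apply: Mj; rewrite R compf1.
  by rewrite -(compf1 f) -(compf1 g) -R -!compA Ei.
Qed.

Definition descends (f : Hom (H ⊗ H) (H ⊗ H)) (g : Hom Inv Inv) :=
  exists (fE : Hom E E) (fQ : Hom Q Q),
    f ∘ iota = iota ∘ fE /\ g ∘ ei = ei ∘ fE /\ pi ∘ f = fQ ∘ pi /\ j ∘ g = fQ ∘ j.

Lemma YD_coinvariants f : is_YD_morphism H m D S p f -> exists fE, f ∘ iota = iota ∘ fE.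
Proof.
  move=> [_ F]. case: Hiota => [C U].
  case: (U _ (f ∘ iota)).
  - by rewrite (tail22 F) C (tail22 (triv_coact_nat f)).
  - move=> k [<- _]. by exists k.
Qed.

Lemma YD_invariants f : is_YD_morphism H m D S p f -> exists fQ, pi ∘ f = fQ ∘ pi.
Proof.
  move=> [F _]. case: Hpi => [C U].
  case: (U _ (pi ∘ f)).
  - by rewrite !compA F (tail22 C) triv_act_nat.
  - move=> k [<- _]. by exists k.
Qed.

(** The map [g] comes from minimality of the image, applied to the factorisation of [pi ∘ iota]
    through [fQ' ∘ j], where [fQ'] is induced by the inverse [f']. Since [fQ] and [fQ'] are mutually
    inverse, [fQ' ∘ j] is mono and the resulting equation turns into [j ∘ g = fQ ∘ j]. *)
Lemma YD_descends f f' : is_inverse f f' -> is_YD_morphism H m D S p f ->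
  exists g, descends f g.
Proof.
  move=> I Y. have Y' := YD_inverse I Y. case: I => [I1 I2].
  case: (YD_coinvariants Y) => fE EE.
  case: (YD_invariants Y) => fQ EQ. case: (YD_invariants Y') => fQ' EQ'.
  have J1 : fQ' ∘ fQ = id_.
  { apply: pi_epi. by rewrite compA -EQ -compA -EQ' compA I1 compf1 comp1f. }
  have J2 : fQ ∘ fQ' = id_.
  { apply: pi_epi. by rewrite compA -EQ' -compA -EQ compA I2 compf1 comp1f. }
  case: Himage => [Ej [Mj Im]].
  have M' : is_mono (fQ' ∘ j).
  { move=> Z x y. rewrite !compA => G. apply: Mj. exact: (split_mono_cancel J2 G). }
  case: (Im _ (ei ∘ fE) (fQ' ∘ j) M').
  - by rewrite compA -(compA j) Ej compA -EE -(compA pi) EQ compA (tail20 J1).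
  - move=> g Eg.
    have Jg : j ∘ g = fQ ∘ j.
    { by rewrite -{2}Eg compA (tail20 J2). }
    exists g, fE, fQ. split => //. split => //.
    apply: Mj. by rewrite -!compA Jg compA Ej -compA -EQ compA EE -compA.
Qed.

Lemma descends_comp f f' g g' : descends f g -> descends f' g' -> descends (f ∘ f') (g ∘ g').
Proof.
  move=> [fE [fQ [A1 [A2 [A3 A4]]]]] [fE' [fQ' [B1 [B2 [B3 B4]]]]].
  exists (fE ∘ fE'), (fQ ∘ fQ').
  split; first by rewrite compA B1 -compA A1 compA.
  split; first by rewrite compA B2 -compA A2 compA.
  split; first by rewrite -compA A3 compA B3 compA.
  by rewrite -compA A4 compA B4 compA.
Qed.

Lemma descends_id : descends id_ id_.
Proof. exists id_, id_. by rewrite !comp1f !compf1. Qed.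

(** The map on [Q] is determined because [pi] is epi, and then the map on [Inv] because [j] is mono.
    Relations among endomorphisms of [H ⊗ H] therefore pass to [Inv]. *)
Lemma descends_unique f g g' : descends f g -> descends f g' -> g = g'.
Proof.
  move=> [_ [fQ [_ [_ [A B]]]]] [_ [fQ' [_ [_ [A' B']]]]].
  case: Himage => [_ [Mj _]]. apply: Mj. rewrite B B'.
  by rewrite (pi_epi (f := fQ) (g := fQ')) // -A -A'.
Qed.

(** Since [ei] is epi and [j] is mono, it suffices to compare two maps from [E] to [Q], where
    [sandwich] applies. *)
Lemma descends_twist f g : finitely_complete K ->
  f = act ∘ ((Tpiv H m S p ⊠ id_) ∘ coact) -> descends f g -> g = id_.
Proof.
  move=> FC Ef [fE [fQ [A1 [A2 [A3 A4]]]]].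
  apply: (image_epi FC). case: Himage => [Ej [Mj _]]. apply: Mj.
  case: Hiota => [CI _]. case: Hpi => [CP _].
  rewrite comp1f -(compA j) A4 compA Ej -(compA fQ) -A3 Ef.
  exact: sandwich CI CP triv_act_coact.
Qed.

Lemma slides_descend : finitely_complete K -> exists ga gai gb gbi : Hom Inv Inv,
  defines_hom SL2Z_rels ga gai gb gbi /\ descends Da ga /\ descends Db gb.
Proof.
  move=> FC.
  have Ia := slide_a_inverse. have Ib := slide_b_inverse.
  have Ia' : is_inverse Da' Da by case: Ia.
  have Ib' : is_inverse Db' Db by case: Ib.
  case: (YD_descends Ia slide_a_YD) => ga Ga.
  case: (YD_descends Ib slide_b_YD) => gb Gb.
  case: (YD_descends Ia' (YD_inverse Ia slide_a_YD)) => gai Gai.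
  case: (YD_descends Ib' (YD_inverse Ib slide_b_YD)) => gbi Gbi.
  have inv f f' g g' : is_inverse f f' -> descends f g -> descends f' g' -> is_inverse g g'.
  { move=> [I1 I2] P P'. split.
    - apply: (descends_unique _ descends_id). rewrite -I1. exact: descends_comp.
    - apply: (descends_unique _ descends_id). rewrite -I2. exact: descends_comp. }
  exists ga, gai, gb, gbi. split; last by [].
  apply: defines_hom_of_rels; [exact: inv Ia Ga Gai|exact: inv Ib Gb Gbi|].
  move=> r r' /= [[<- <-]|[[<- <-]|//]]; rewrite /eval_word /= !compf1.
  (* This relation fails in general on [H ⊗ H] and holds only after descent; the braid relation
     below is inherited directly. *)
  - apply: (descends_twist FC slide_full_twist).
    by repeat apply: descends_comp.
  - apply: (descends_unique (f := Da ∘ (Db ∘ Da))); last rewrite slide_braid;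
      by repeat apply: descends_comp.
Qed.
End Invariants.
End Wires.
End Structural.

Theorem theorem7p1 (K : SMCOps) (HK : is_SMC K) (H : K)
    (m : Hom (H ⊗ H) H) (u : Hom unitob H) (D : Hom H (H ⊗ H)) (e : Hom H unitob)
    (S : Hom H H) (HH : is_Hopf H m u D e S)
    (p : Hom unitob H) (Hp : is_pivotal H m D e S p) :
  (* (1) rho : B_3 -> Aut_YD(H⊗H), A ↦ D_a, B ↦ D_b *)
  (exists Dai Dbi : Hom (H ⊗ H) (H ⊗ H),
     defines_hom B3_rels (slide_a H m D S) Dai (slide_b H m D) Dbi /\
     is_YD_morphism H m D S p (slide_a H m D S) /\
     is_YD_morphism H m D S p (slide_b H m D)) /\
  (* (2) rho : SL(2,Z) -> Aut(H⊗H_inv) induced by D_a, D_b *)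
  (finitely_complete K -> finitely_cocomplete K ->
   forall (E : K) (iota : Hom E (H ⊗ H)),
     is_equaliser iota (delta_f H m D S p) (triv_coact H u) ->
   forall (Q : K) (pi : Hom (H ⊗ H) Q),
     is_coequaliser pi (rho_v H m D S) (triv_act H e) ->
   forall (Inv : K) (ei : Hom E Inv) (j : Hom Inv Q),
     is_image (pi ∘ iota) ei j ->
   exists ga gai gb gbi : Hom Inv Inv,
     defines_hom SL2Z_rels ga gai gb gbi /\
     (exists (faE : Hom E E) (faQ : Hom Q Q),
        slide_a H m D S ∘ iota = iota ∘ faE /\ ga ∘ ei = ei ∘ faE /\
        pi ∘ slide_a H m D S = faQ ∘ pi /\ j ∘ ga = faQ ∘ j) /\
     (exists (fbE : Hom E E) (fbQ : Hom Q Q),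
        slide_b H m D ∘ iota = iota ∘ fbE /\ gb ∘ ei = ei ∘ fbE /\
        pi ∘ slide_b H m D = fbQ ∘ pi /\ j ∘ gb = fbQ ∘ j)).
Proof.
  split.
  - exists (slide_a H m D (idm H)), (slide_b H (comp m (tensm (S_inverse m S p) (idm H))) D).
    split; last exact: (conj (slide_a_YD HK HH Hp) (slide_b_YD HK HH Hp)).
    apply: (defines_hom_of_rels HK (slide_a_inverse HK HH Hp) (slide_b_inverse HK HH Hp)).
    move=> r r' [[<- <-]|//]. rewrite /eval_word /= !(compf1 HK).
    exact: (slide_braid HK HH Hp).
  - move=> FC _ E iota Hiota Q pi Hpi Inv ei j Himage.
    exact: (slides_descend HK HH Hp Hiota Hpi Himage FC).
Qed.
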